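(* Let $A,M,S$ be positive integers with $M\ge S^2$ and $M$ even, and let $L=M/2$. Let $\alpha,\beta>0$ and let $\Omega=\{\omega_j\}_{j=1}^S\subset\mathbb{T}$ satisfy the clumps model with a minimum separation with parameters $(A,L,S,\beta,\alpha)$, with clump cardinalities $\lambda_1,\dots,\lambda_A$, where $$\beta\ge\max_{1\le a\le A}\frac{20\,S^{1/2}\lambda_a^{5/2}}{\alpha^{1/2}}.$$ For $1\le a\le A$ let $c_a=C_a(\lambda_a,L)$. Let $x\in\mathbb{C}^S$, $\eta\in\mathbb{C}^{M+1}$, $y=\Phi(\Omega,M)x+\eta$ and $x_{\min}=\min_j|x_j|$. If $$4\|\mathcal{H}(\eta)\|_2\sum_{a=1}^A\big(c_a\alpha^{-\lambda_a+1}\big)^2<x_{\min}M,$$ then $$\sup_{\omega\in[0,1)}|\hat{\mathcal{R}}(\omega)-\mathcal{R}(\omega)|\le\frac{4\|\mathcal{H}(\eta)\|_2}{x_{\min}M}\sum_{a=1}^A\big(c_a\,\alpha^{-\lambda_a+1}\big)^2 .$$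
   Context: $\mathbb{T}=[0,1)$ is the periodic unit interval, $|\omega|_{\mathbb{T}}:=\min_{n\in\mathbb{Z}}|\omega-n|$. $\Phi(\Omega,M)$ is the $(M+1)\times S$ matrix with entries $e^{-2\pi i m\omega_j}$, $0\le m\le M$, $1\le j\le S$. Clumps model with a minimum separation with parameters $(A,L,S,\beta,\alpha)$: (1) $\Omega$ has cardinality $S$ and is a disjoint union $\Omega=\bigcup_{a=1}^A\Lambda_a$ of nonempty finite sets, each $\Lambda_a$ contained in an open interval (arc) of length $1/L$; (2) if $A>1$, then $|\omega-\omega'|_{\mathbb{T}}\ge\beta/L$ whenever $\omega,\omega'$ belong to different $\Lambda_a$'s; (3) $\min_{j\ne k}|\omega_j-\omega_k|_{\mathbb{T}}\ge\alpha/L$ and $\max_a(\lambda_a-1)<1/\alpha$, where $\lambda_a=|\Lambda_a|$. Constants: for a positive integer $\lambda$ and an integer $L\ge\lambda$, $$B(\lambda,L):=\tfrac{20\sqrt2}{19}\Big(1-\tfrac{\pi^2}{3\lambda^2}\Big)^{-(\lambda-1)/2}\Big(\tfrac{L}{\lambda}\Big)^{\lambda-1}\Big\lfloor\tfrac{L}{\lambda}\Big\rfloor^{-(\lambda-1)},$$ $$C_a(\lambda,L):=B(\lambda,L)\,\lambda\Big(\tfrac{\lambda}{\pi}\Big)^{\lambda-1}\Big(\sum_{j=1}^{\lambda}\prod_{k=1,k\ne j}^{\lambda}\tfrac{1}{(j-k)^2}\Big)^{1/2}$$ (powers with exponent $0$ and empty products equal $1$). MUSIC notation: for $z=(z_0,\dots,z_M)\in\mathbb{C}^{M+1}$,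 $\mathcal{H}(z)\in\mathbb{C}^{(L+1)\times(M-L+1)}$ is the Hankel matrix with entries $\mathcal{H}(z)_{p,q}=z_{p+q}$, $0\le p\le L$, $0\le q\le M-L$; $\|\cdot\|_2$ is the spectral norm. With $y^0=\Phi(\Omega,M)x$, the matrix $\mathcal{H}(y^0)$ has rank $S$ when all $x_j\ne0$; $W$ is a matrix whose columns form an orthonormal basis of $\mathrm{Range}(\mathcal{H}(y^0))^\perp$ in $\mathbb{C}^{L+1}$. $\hat W$ is the matrix whose $L+1-S$ columns are the left singular vectors in a (full) singular value decomposition of $\mathcal{H}(y)$, with singular values in decreasing order, other than the first $S$ left singular vectors. With $\phi_L(\omega)=(1,e^{-2\pi i\omega},\dots,e^{-2\pi iL\omega})^T\in\mathbb{C}^{L+1}$, the noise-space correlation functions are $$\mathcal{R}(\omega)=\frac{\|W^*\phi_L(\omega)\|_2}{\|\phi_L(\omega)\|_2},\qquad \hat{\mathcal{R}}(\omega)=\frac{\|\hat W^*\phi_L(\omega)\|_2}{\|\phi_L(\omega)\|_2}.$$ *)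

(* Defs.v *)
From HB Require Import structures.
From mathcomp Require Import all_boot all_order all_algebra.
From mathcomp Require Import complex.
From mathcomp Require Import all_classical all_reals all_analysis.

Set Implicit Arguments.
Unset Strict Implicit.
Unset Printing Implicit Defensive.

Import Order.TTheory GRing.Theory Num.Theory.

Local Open Scope classical_set_scope.
Local Open Scope ring_scope.
Local Open Scope complex_scope.
Local Open Scope sesquilinear_scope.

Section Torus.
Variable R : realType.

(* The infimum is attained (lemmas below), so it is the minimum over the
   integers. *)
Definition distT (w : R) : R := inf (range (fun n : int => `|w - n%:~R|)).

Lemma distT_le (w : R) (n : int) : distT w <= `|w - n%:~R|.
Proof.
apply: ge_inf; last by exists n.
by exists 0 => _ [m _ <-]; exact: normr_ge0.
Qed.

Lemma distT_attained (w : R) : exists n : int, distT w = `|w - n%:~R|.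
Proof.
set f := Num.floor w.
have fl : f%:~R <= w by have /andP[] := floor_itv w.
have fu : w < (f + 1)%:~R by have /andP[] := floor_itv w.
have key (n : int) :
    Order.min `|w - f%:~R| `|w - (f + 1)%:~R| <= `|w - n%:~R|.
  case: (leP n f) => nf.
    have nfR : n%:~R <= f%:~R :> R by rewrite ler_int.
    rewrite ge_min; apply/orP; left.
    rewrite !ger0_norm ?subr_ge0 ?(le_trans nfR) //.
    by rewrite lerB.
  have nfR : (f + 1)%:~R <= n%:~R :> R by rewrite ler_int lezD1.
  rewrite ge_min; apply/orP; right.
  rewrite !ler0_norm ?subr_le0 ?(ltW fu) ?(le_trans (ltW fu)) //.
  by rewrite lerN2 lerB.
have le : Order.min `|w - f%:~R| `|w - (f + 1)%:~R| <= distT w.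
  apply: lb_le_inf; first by exists `|w - 0%:~R|, 0.
  by move=> _ [n _ <-]; exact: key.
case: (leP `|w - f%:~R| `|w - (f + 1)%:~R|) le => _ le.
  by exists f; apply/eqP; rewrite eq_le le distT_le.
by exists (f + 1); apply/eqP; rewrite eq_le le distT_le.
Qed.

End Torus.

Section Model.
Variable R : realType.

(* [Omega] is the set of values of the injective family [omega]; the clump
   Lambda_a is the set of those omega_j with j in [Lam a]. *)
Record clumps_model (A L S : nat) (beta alpha : R)
    (omega : 'I_S -> R) (Lam : 'I_A -> {set 'I_S}) : Prop := ClumpsModel {
  clumps_torus : forall j, 0 <= omega j < 1 ;
  clumps_inj : injective omega ;
  clumps_cover : (\bigcup_(a < A) Lam a)%SET = [set: 'I_S]%SET ;
  clumps_disjoint : forall a b : 'I_A, a != b -> (Lam a :&: Lam b)%SET = finset.set0 ;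
  clumps_neq0 : forall a, Lam a != finset.set0 ;
  (* The arc is the image in R/Z of the open interval ]t, t + 1/L[. *)
  clumps_arc : forall a, exists t : R, forall j, j \in Lam a ->
    exists n : int, t < omega j + n%:~R < t + L%:R^-1 ;
  clumps_dist : forall a b : 'I_A, a != b ->
    forall j k, j \in Lam a -> k \in Lam b ->
    beta / L%:R <= distT (omega j - omega k) ;
  clumps_minsep : forall j k : 'I_S, j != k ->
    alpha / L%:R <= distT (omega j - omega k) ;
  clumps_card : forall a, #|Lam a|%:R - 1 < alpha^-1
}.

(* [powR] is 1 at exponent 0 whatever the base, which covers lam = 1, the only
   case in which the base is negative. *)
Definition clump_B (lam L : nat) : R :=
  (20 * Num.sqrt 2 / 19)
  * (1 - pi ^+ 2 / (3 * lam%:R ^+ 2)) `^ (- ((lam%:R - 1) / 2))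
  * (L%:R / lam%:R) ^+ lam.-1
  * (L %/ lam)%N%:R ^- lam.-1.

Definition clump_C (lam L : nat) : R :=
  clump_B lam L * lam%:R * (lam%:R / pi) ^+ lam.-1
  * Num.sqrt (\sum_(1 <= j < lam.+1)
      \prod_(1 <= k < lam.+1 | k != j) ((j%:R - k%:R) ^+ 2)^-1).

End Model.

Section Music.
Variable R : realType.

(* exp(i t) *)
Definition cexpi (t : R) : R[i] := cos t +i* sin t.

Definition cmod (z : R[i]) : R := ComplexField.Normc.normc z.

Definition l2norm n (v : 'cV[R[i]]_n) : R :=
  Num.sqrt (\sum_(i < n) cmod (v i 0) ^+ 2).

Definition spectral_norm m n (B : 'M[R[i]]_(m, n)) : R :=
  sup [set l2norm (B *m v) | v in [set v : 'cV[R[i]]_n | l2norm v <= 1]].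

Definition fourier_mx (M S : nat) (omega : 'I_S -> R) : 'M[R[i]]_(M.+1, S) :=
  \matrix_(m < M.+1, j < S) cexpi (- (2 * pi * m%:R * omega j)).

(* For L <= M the index p + q is at most M, so [inord] does not truncate. *)
Definition hankel (M L : nat) (z : 'cV[R[i]]_M.+1)
    : 'M[R[i]]_(L.+1, (M - L).+1) :=
  \matrix_(p < L.+1, q < (M - L).+1) z (inord (p + q)) 0.

Definition steering (L : nat) (w : R) : 'cV[R[i]]_L.+1 :=
  \col_(m < L.+1) cexpi (- (2 * pi * m%:R * w)).

Definition orthobasis_range_perp m n k
    (H : 'M[R[i]]_(m, n)) (W : 'M[R[i]]_(m, k)) : Prop :=
  W ^t* *m W = 1%:M /\
  forall v : 'cV[R[i]]_m,
    (exists c : 'cV[R[i]]_k, v = W *m c) <->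
    (forall u : 'cV[R[i]]_n, (H *m u) ^t* *m v = 0).

Definition is_svd m n (H : 'M[R[i]]_(m, n))
    (U : 'M[R[i]]_m) (Sigma : 'M[R]_(m, n)) (V : 'M[R[i]]_n) : Prop :=
  [/\ U \is unitarymx /\ V \is unitarymx,
      is_diag_mx Sigma,
      forall i j, 0 <= Sigma i j,
      forall (i i' : 'I_m) (j j' : 'I_n), i = j :> nat -> i' = j' :> nat ->
        (i <= i')%N -> Sigma i' j' <= Sigma i j
    & H = U *m map_mx (real_complex R) Sigma *m V ^t*].

(* The columns of [U] other than the first [S]. *)
Definition last_cols (L S : nat) (U : 'M[R[i]]_L.+1)
    : 'M[R[i]]_(L.+1, L.+1 - S) :=
  \matrix_(i < L.+1, j < L.+1 - S) U i (inord (S + j)).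

Definition noise_corr L k (W : 'M[R[i]]_(L.+1, k)) (w : R) : R :=
  l2norm (W ^t* *m steering L w) / l2norm (steering L w).

End Music.

(* Main.v *)
(** Write z_j = exp(-2 pi i omega_j). The Hankel matrix of the clean data factors
    as Phi diag(x) Phi^T with Phi = Phi(Omega, L), so the theorem has two halves.

    Lower bound for Phi. If p is a polynomial of degree at most L with
    p(z_j) close to the conjugate of v_j, then |v|^2 is close to the pairing of
    the coefficients of p with Phi v, whence |v|^2 <= (20/19) |p| |Phi v|. Such a
    p is a combination of the polynomials p_j, each the product of the Lagrange basis of the clump of
    omega_j, in the variable X^t with t = floor(L/lambda), and of a power
    2 lambda of the normalized Dirichlet kernel of degree floor(L/(2 lambda^2))
    centred at z_j. Its coefficient norm is estimated without Parseval:
    multiplication by X^t - w is bounded by 2 and by a Dirichlet kernel by 1.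
    The damping makes p_j at most 1/(20 S) on the other clumps when
    alpha <= 20; when alpha > 20 all clumps are singletons and the errors are
    summed as inverse squares along the sorted points. In the end
    |Phi v|^2 >= (L / T) |v|^2, with T the sum of the (c_a alpha^(1-lambda_a))^2.

    Perturbation. Put sigma = x_min L / T and e = |H(eta)|. Weyl's inequalities give
    sigma_(S+1)(H(y)) <= e and sigma_S(H(y)) >= sigma - e >= sigma / 2. A vector
    u = H(y^0) w of the clean range with |w| <= |u| / sigma has a component of size
    at most 2 e |w| in the noisy noise space, and a vector u = H(y) w of the noisy
    signal space has the component H(eta) w in the clean noise space; both are at
    most (2 e / sigma) |u|. *)
Require Import Defs.
From mathcomp Require Import all_boot all_order all_algebra.
From mathcomp Require Import complex.
From mathcomp Require Import all_classical all_reals all_analysis.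
From mathcomp Require Import ring lra zify.
Import Order.TTheory GRing.Theory Num.Theory.
Import numFieldNormedType.Exports.
Local Open Scope classical_set_scope.
Local Open Scope ring_scope.
Local Open Scope complex_scope.

Set Implicit Arguments.
Unset Strict Implicit.
Unset Printing Implicit Defensive.

(** * Trigonometric inequalities *)

Section RealTrig.
Variable R : realType.
Implicit Types x : R.

(** The mean value theorem on [[0, x]]. Each Taylor bound below follows from the preceding one,
    which gives the sign of its derivative. *)
Lemma ge0_of_derive (f df : R -> R) :
  (forall x, is_derive x 1 f (df x)) -> f 0 = 0 ->
  (forall x, 0 <= x -> 0 <= df x) -> forall x, 0 <= x -> 0 <= f x.
Proof.
move=> fE f0 df0 x x0.
have cf : {within `[0, x]%classic, continuous f}.
  apply: continuous_subspaceT => y; apply: differentiable_continuous.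
  exact/derivable1_diffP/ex_derive.
have [c] := MVT_segment x0 (fun y _ => fE y) cf.
rewrite in_itv /= f0 !subr0 => /andP[c0 _] ->.
by rewrite mulr_ge0 // df0.
Qed.

Lemma sin_le x : 0 <= x -> sin x <= x.
Proof.
move=> x0; rewrite -subr_ge0.
apply: (@ge0_of_derive (fun y => y - sin y) (fun y => 1 - cos y)) => //.
- by rewrite sin0 subrr.
Qed.

Lemma cos_ge_quadratic x : 0 <= x -> 1 - x ^+ 2 / 2 <= cos x.
Proof.
move=> x0; rewrite -subr_ge0.
apply: (@ge0_of_derive (fun y => cos y - (1 - y ^+ 2 / 2)) (fun y =>
  y - sin y)).
- move=> y; apply: is_derive_eq.
  by rewrite /GRing.scale /=; field.
- by rewrite cos0 expr0n /= mul0r subr0 subrr.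
- by move=> y y0; rewrite subr_ge0 sin_le.
- by [].
Qed.

Lemma sin_ge_cubic x : 0 <= x -> x - x ^+ 3 / 6 <= sin x.
Proof.
move=> x0; rewrite -subr_ge0.
apply: (@ge0_of_derive (fun y => sin y - (y - y ^+ 3 / 6))
  (fun y => cos y - (1 - y ^+ 2 / 2))).
- move=> y; apply: is_derive_eq.
  by rewrite /GRing.scale /=; field.
- by rewrite sin0 expr0n /= mul0r !subrr.
- by move=> y y0; rewrite subr_ge0 cos_ge_quadratic.
- by [].
Qed.

Lemma cos_le_quartic x : 0 <= x -> cos x <= 1 - x ^+ 2 / 2 + x ^+ 4 / 24.
Proof.
move=> x0; rewrite -subr_ge0.
apply: (@ge0_of_derive (fun y => (1 - y ^+ 2 / 2 + y ^+ 4 / 24) - cos y)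
  (fun y => sin y - (y - y ^+ 3 / 6))).
- move=> y; apply: is_derive_eq.
  by rewrite /GRing.scale /=; field.
- by rewrite cos0 !expr0n /= !mul0r subr0 addr0 subrr.
- by move=> y y0; rewrite subr_ge0 sin_ge_cubic.
- by [].
Qed.

(** At pi/2 the quartic bound reads s^2 - 12 s + 24 >= 0 with s = (pi/2)^2; since s < 4, s is at
    most the smaller root 6 - 2 sqrt 3 < 3. The value 12 is what makes 1 - pi^2/(3 lambda^2)
    positive from lambda = 2 on. *)
Lemma sqr_pi_lt12 : pi ^+ 2 < 12 :> R.
Proof.
have [_ c0] := pihalf_02_cos_pihalf R.
have := cos_le_quartic (ltW (lt_le_trans ltr01 (pihalf_ge1 R))).
rewrite c0; have := pihalf_ge1 R; have := pihalf_lt2 R.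
have -> : pi = 2 * (pi / 2) :> R by rewrite mulrC mulfVK.
move: (pi / 2 : R) => p p2 p1 h.
have h2 : 0 <= (p ^+ 2) ^+ 2 - 12 * p ^+ 2 + 24 by rewrite -exprM; nra.
have s1 : p ^+ 2 < 4 by nra.
have s2 : 1 <= p ^+ 2 by nra.
have -> : (2 * p) ^+ 2 = 4 * p ^+ 2 by ring.
move: (p ^+ 2) h2 s1 s2 => s; nra.
Qed.

(** The cubic bound is nonnegative because x^2 < 3, so it can be squared; the term (x^3/6)^2 is then
    dropped. *)
Lemma sqr_sin_ge x : 0 <= x <= pi / 2 -> x ^+ 2 * (1 - x ^+ 2 / 3) <= sin x ^+
  2.
Proof.
move=> /andP[x0 xp]; have h := sin_ge_cubic x0.
have x2 : x ^+ 2 < 3.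
  have := sqr_pi_lt12; have : x ^+ 2 <= (pi / 2) ^+ 2
    by rewrite lerXn2r ?nnegrE // (le_trans x0).
  rewrite expr_div_n; lra.
have c0 : 0 <= x - x ^+ 3 / 6.
  have -> : x - x ^+ 3 / 6 = x * (1 - x ^+ 2 / 6) by field.
  by rewrite mulr_ge0 //; lra.
have : (x - x ^+ 3 / 6) ^+ 2 <= sin x ^+ 2.
  by rewrite lerXn2r ?nnegrE // (le_trans c0).
apply: le_trans; rewrite -subr_ge0.
have -> : (x - x ^+ 3 / 6) ^+ 2 - x ^+ 2 * (1 - x ^+ 2 / 3) = (x ^+ 3 / 6) ^+ 2.
  by field.
exact: sqr_ge0.
Qed.

(** Concavity: the slopes of the chords over [[0, x]] and [[x, pi / 2]] are values of cosine at
    successive points, hence decrease. *)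
Lemma sin_ge_chord x : 0 <= x <= pi / 2 -> 2 * x / pi <= sin x.
Proof.
have pi0 := pi_gt0 R.
move=> /andP[]; rewrite le_eqVlt => /predU1P[<- _|x0].
  by rewrite mulr0 mul0r sin0.
rewrite le_eqVlt => /predU1P[->|xp].
  by rewrite sin_pihalf mulrCA divff ?mulr1 ?divff // gt_eqF.
have cs a b : {within `[a, b]%classic, continuous (@sin R)}.
  by apply: continuous_subspaceT; exact: continuous_sin.
have [c + E1] := MVT x0 (fun y _ => is_derive_sin y) (cs _ _).
have [d + E2] := MVT xp (fun y _ => is_derive_sin y) (cs _ _).
rewrite !in_itv /= => /andP[d1 d2] /andP[c1 c2].
have cd : cos d <= cos c.
  have cpi : c \in `[0, pi] by rewrite in_itv /= (ltW c1) /=; lra.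
  have dpi : d \in `[0, pi].
    by rewrite in_itv /= (ltW (lt_trans x0 d1)) /=; lra.
  by rewrite leNgt (ltr_cos dpi cpi) -leNgt (ltW (lt_trans c2 d1)).
move: E1 E2; rewrite sin_pihalf sin0 !subr0 => E1 E2.
have key : 0 <= x * (pi / 2 - x) * (cos c - cos d).
  by rewrite !mulr_ge0 // ?subr_ge0 // ltW.
rewrite ler_pdivrMr //.
have : x * (1 - sin x) <= (pi / 2 - x) * sin x.
  rewrite E2 E1 -subr_ge0; move: key; congr (_ <= _); ring.
lra.
Qed.

End RealTrig.

(** * Moduli and norms *)

Section CauchySchwarz.
Variables (R : realFieldType) (I : finType).
Implicit Types a b : I -> R.

(** Lagrange's identity: twice the difference of the two sides is the double sum of the squares of
    a_i b_j - a_j b_i. *)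
Lemma cauchy_schwarz a b :
  (\sum_i a i * b i) ^+ 2 <= (\sum_i a i ^+ 2) * (\sum_i b i ^+ 2).
Proof.
have e1 : (\sum_i a i ^+ 2) * (\sum_i b i ^+ 2) =
    \sum_i \sum_j (a i * b j) ^+ 2.
  rewrite big_distrl; apply: eq_bigr => i _; rewrite big_distrr.
  by apply: eq_bigr => j _; rewrite exprMn.
have e2 : (\sum_i a i ^+ 2) * (\sum_i b i ^+ 2) =
    \sum_i \sum_j (a j * b i) ^+ 2.
  by rewrite e1 exchange_big.
have e3 : (\sum_i a i * b i) ^+ 2 =
    \sum_i \sum_j (a i * b j) * (a j * b i).
  rewrite expr2 big_distrl; apply: eq_bigr => i _; rewrite big_distrr.
  by apply: eq_bigr => j _ /=; ring.
rewrite -subr_ge0 -(pmulr_rge0 _ (ltr0Sn R 1)) mulrBr mulrDl mul1r {1}e1 e2 e3.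
rewrite -big_split big_distrr -sumrB /=; apply: sumr_ge0 => i _.
rewrite -big_split big_distrr -sumrB /=; apply: sumr_ge0 => j _.
have -> : (a i * b j) ^+ 2 + (a j * b i) ^+ 2 - (1 + 1) * (a i * b j * (a j * b
  i))
   = (a i * b j - a j * b i) ^+ 2 by ring.
exact: sqr_ge0.
Qed.

End CauchySchwarz.

Section CauchySchwarzSqrt.
Variables (R : rcfType) (I : finType).
Implicit Types a b : I -> R.

Lemma cauchy_schwarz_sqrt a b :
  \sum_i a i * b i <=
  Num.sqrt (\sum_i a i ^+ 2) * Num.sqrt (\sum_i b i ^+ 2).
Proof.
rewrite -sqrtrM ?sumr_ge0 // => [|i _]; last exact: sqr_ge0.
apply: le_trans (ler_norm _) _; rewrite -sqrtr_sqr ler_sqrt ?cauchy_schwarz //.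
by rewrite mulr_ge0 // sumr_ge0 // => i _; rewrite sqr_ge0.
Qed.

Lemma minkowski_sqrt a b :
  Num.sqrt (\sum_i (a i + b i) ^+ 2) <=
  Num.sqrt (\sum_i a i ^+ 2) + Num.sqrt (\sum_i b i ^+ 2).
Proof.
have sq0 (c : I -> R) : 0 <= \sum_i c i ^+ 2.
  by apply: sumr_ge0 => i _; rewrite sqr_ge0.
rewrite -(ler_pXn2r (ltn0Sn 1)) ?nnegrE ?addr_ge0 ?sqrtr_ge0 //.
rewrite sqrrD !sqr_sqrtr //.
under eq_bigr => i _ do rewrite sqrrD.
rewrite !big_split /= lerD2r lerD2l.
rewrite -mulr2n lerMn2r.
exact: cauchy_schwarz_sqrt.
Qed.

End CauchySchwarzSqrt.

Section Cmod.
Variable R : realType.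
Implicit Types z w : R[i].

Lemma cmodE z : `|z| = (cmod z)%:C.
Proof. by []. Qed.

Lemma cmod_ge0 z : 0 <= cmod z.
Proof. by rewrite -lecR -cmodE normr_ge0. Qed.

Lemma cmod0 : cmod (0 : R[i]) = 0.
Proof. by apply: (@complexI R); rewrite -cmodE normr0. Qed.

Lemma cmod1 : cmod (1 : R[i]) = 1.
Proof. by apply: (@complexI R); rewrite -cmodE normr1. Qed.

Lemma cmod_eq0 z : (cmod z == 0) = (z == 0).
Proof.
apply/eqP/eqP => [|->]; last exact: cmod0.
exact: ComplexField.Normc.eq0_normc.
Qed.

Lemma cmodM z w : cmod (z * w) = cmod z * cmod w.
Proof. exact: ComplexField.Normc.normcM. Qed.

Lemma cmodV z : cmod z^-1 = (cmod z)^-1.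
Proof. exact: ComplexField.Normc.normcV. Qed.

Lemma cmodX z n : cmod (z ^+ n) = cmod z ^+ n.
Proof. by elim: n => [|n IH]; rewrite ?cmod1 // !exprS cmodM IH. Qed.

Lemma cmodN z : cmod (- z) = cmod z.
Proof. by apply: (@complexI R); rewrite -!cmodE normrN. Qed.

Lemma cmodD z w : cmod (z + w) <= cmod z + cmod w.
Proof. by rewrite -lecR rmorphD /= -!cmodE ler_normD. Qed.

Lemma cmodB z w : cmod (z - w) <= cmod z + cmod w.
Proof. by rewrite -(cmodN w) cmodD. Qed.

Lemma cmod_sum (I : Type) (r : seq I) (P : pred I) (F : I -> R[i]) :
  cmod (\sum_(i <- r | P i) F i) <= \sum_(i <- r | P i) cmod (F i).
Proof.
elim/big_rec2: _ => [|i y z _ le]; first by rewrite cmod0.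
by apply: le_trans (cmodD _ _) _; rewrite lerD2l.
Qed.

Lemma cmod_prod (I : Type) (r : seq I) (P : pred I) (F : I -> R[i]) :
  cmod (\prod_(i <- r | P i) F i) = \prod_(i <- r | P i) cmod (F i).
Proof. by apply: (big_morph _ cmodM cmod1). Qed.

Lemma cmod_conj z : cmod (z ^* )%R = cmod z.
Proof. by apply: (@complexI R); rewrite -!cmodE norm_conjC. Qed.

Lemma cmodR (x : R) : cmod x%:C = `|x|.
Proof. by rewrite /cmod /= expr0n /= addr0 sqrtr_sqr. Qed.

Lemma cmod_sq z : (cmod z ^+ 2)%:C = ((z ^* ) * z)%R.
Proof. by rewrite rmorphXn /= -cmodE normCK mulrC. Qed.

Lemma cmod_nat n : cmod (n%:R : R[i]) = n%:R.
Proof. by apply: (@complexI R); rewrite -cmodE normr_nat rmorph_nat. Qed.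

End Cmod.

Section L2norm.
Local Open Scope sesquilinear_scope.
Variable R : realType.
Local Notation C := R[i].

Lemma sum_cmod_sq_ge0 (I : finType) (P : pred I) (F : I -> C) :
  0 <= \sum_(i | P i) cmod (F i) ^+ 2.
Proof. by apply: sumr_ge0 => i _; rewrite sqr_ge0. Qed.

Lemma l2norm_sq n (v : 'cV[C]_n) : l2norm v ^+ 2 = \sum_i cmod (v i 0) ^+ 2.
Proof. by rewrite sqr_sqrtr // sum_cmod_sq_ge0. Qed.

Lemma l2norm_ge0 n (v : 'cV[C]_n) : 0 <= l2norm v.
Proof. exact: sqrtr_ge0. Qed.

Lemma l2norm0 n : l2norm (0 : 'cV[C]_n) = 0.
Proof.
by rewrite /l2norm big1 ?sqrtr0 // => i _; rewrite mxE cmod0 expr0n.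
Qed.

Lemma l2norm_eq0 n (v : 'cV[C]_n) : (l2norm v == 0) = (v == 0).
Proof.
apply/eqP/eqP => [v0|->]; last exact: l2norm0.
have := l2norm_sq v; rewrite v0 expr0n /= => /esym/eqP.
rewrite psumr_eq0 => [/allP h|i _]; last exact: sqr_ge0.
apply/colP => i; have := h i (mem_index_enum i).
by rewrite /= sqrf_eq0 cmod_eq0 mxE => /eqP.
Qed.

Lemma l2norm_gt0 n (v : 'cV[C]_n) : (0 < l2norm v) = (v != 0).
Proof. by rewrite lt0r l2norm_ge0 andbT l2norm_eq0. Qed.

Lemma l2normD n (u v : 'cV[C]_n) : l2norm (u + v) <= l2norm u + l2norm v.
Proof.
apply: le_trans (minkowski_sqrt _ _).
rewrite ler_sqrt; last by apply: sumr_ge0 => i _; rewrite sqr_ge0.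
apply: ler_sum => i _; rewrite lerXn2r ?nnegrE ?addr_ge0 ?cmod_ge0 //.
by rewrite mxE cmodD.
Qed.

Lemma l2normN n (v : 'cV[C]_n) : l2norm (- v) = l2norm v.
Proof. by congr Num.sqrt; apply: eq_bigr => i _; rewrite mxE cmodN. Qed.

Lemma l2normZ n (a : C) (v : 'cV[C]_n) : l2norm (a *: v) = cmod a * l2norm v.
Proof.
rewrite -[X in _ = X * _](ger0_norm (cmod_ge0 a)) -sqrtr_sqr -sqrtrM ?sqr_ge0
  //.
rewrite big_distrr; congr Num.sqrt; apply: eq_bigr => i _.
by rewrite mxE cmodM exprMn.
Qed.

Lemma le_l2norm n (u : 'cV[C]_n) x : 0 <= x ->
  \sum_i cmod (u i 0) ^+ 2 <= x ^+ 2 -> l2norm u <= x.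
Proof.
by move=> x0; rewrite -l2norm_sq ler_pXn2r // nnegrE l2norm_ge0.
Qed.

Lemma dot_self n (v : 'cV[C]_n) : (v ^t* *m v) 0 0 = (l2norm v ^+ 2)%:C.
Proof.
rewrite l2norm_sq rmorph_sum /= mxE; apply: eq_bigr => i _.
by rewrite cmod_sq !mxE.
Qed.

Lemma cmod_dot_le n (u v : 'cV[C]_n) :
  cmod ((u ^t* *m v) 0 0) <= l2norm u * l2norm v.
Proof.
rewrite mxE; apply: le_trans (cmod_sum _ _ _) _.
under eq_bigr => i _ do rewrite !mxE cmodM cmod_conj.
exact: cauchy_schwarz_sqrt.
Qed.

Lemma adj_mul m n p (A : 'M[C]_(m, n)) (B : 'M[C]_(n, p)) :
  (A *m B) ^t* = B ^t* *m A ^t*.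
Proof. by rewrite trmx_mul map_mxM. Qed.

Lemma adjK m n (A : 'M[C]_(m, n)) : (A ^t*) ^t* = A.
Proof. by apply/matrixP => i j; rewrite !mxE conjCK. Qed.

Lemma l2norm_isometry m n (U : 'M[C]_(m, n)) (v : 'cV[C]_n) :
  U ^t* *m U = 1%:M -> l2norm (U *m v) = l2norm v.
Proof.
move=> UU; apply/eqP; rewrite -(eqrXn2 (ltn0Sn 1)) ?l2norm_ge0 //.
apply/eqP/(@complexI R); rewrite -!dot_self adj_mul -mulmxA (mulmxA _ U) UU.
by rewrite mul1mx.
Qed.

(** With w = U* v, |w|^2 = <U w, v> <= |U w| |v| = |w| |v|. *)
Lemma l2norm_coisometry_le m n (U : 'M[C]_(m, n)) (v : 'cV[C]_m) :
  U ^t* *m U = 1%:M -> l2norm (U ^t* *m v) <= l2norm v.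
Proof.
move=> UU; have [->|/negPf u0] := eqVneq (U ^t* *m v) 0.
  by rewrite l2norm0 l2norm_ge0.
have u_gt0 : 0 < l2norm (U ^t* *m v) by rewrite l2norm_gt0 u0.
rewrite -(ler_pM2l u_gt0) -expr2 -(ger0_norm (sqr_ge0 _)) -cmodR -dot_self.
rewrite {1}adj_mul adjK -[X in _ <= X * _](l2norm_isometry _ UU).
by rewrite -mulmxA; apply: le_trans (cmod_dot_le _ _);
  rewrite !adj_mul !adjK !mulmxA.
Qed.

Lemma l2norm_unitary n (U : 'M[C]_n) (v : 'cV[C]_n) :
  U \is unitarymx -> l2norm (U *m v) = l2norm v.
Proof. by move=> /unitarymxP/mulmx1C; exact: l2norm_isometry. Qed.

Lemma l2norm_unitary_adj n (U : 'M[C]_n) (v : 'cV[C]_n) :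
  U \is unitarymx -> l2norm (U ^t* *m v) = l2norm v.
Proof.
by move=> UU; apply: l2norm_isometry; rewrite adjK; apply/unitarymxP.
Qed.

(** The Frobenius norm is a bound, by Cauchy-Schwarz in each row. Boundedness is what keeps [sup]
    from being a default value. *)
Lemma spectral_norm_ub m n (B : 'M[C]_(m, n)) :
  has_ubound [set l2norm (B *m v) | v in [set v : 'cV[C]_n | l2norm v <= 1]].
Proof.
exists (Num.sqrt (\sum_i \sum_j cmod (B i j) ^+ 2)) => _ [v /= v1 <-].
apply: le_l2norm; first exact: sqrtr_ge0.
rewrite sqr_sqrtr; last by apply: sumr_ge0 => i _; exact: sum_cmod_sq_ge0.
apply: ler_sum => i _.
pose u : 'cV[C]_n := \col_j ((B i j)^* )%R.
have -> : \sum_j cmod (B i j) ^+ 2 = l2norm u ^+ 2.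
  by rewrite l2norm_sq; apply: eq_bigr => j _; rewrite mxE cmod_conj.
have -> : (B *m v) i 0 = (u ^t* *m v) 0 0.
  by rewrite !mxE; apply: eq_bigr => j _; rewrite !mxE conjCK.
rewrite lerXn2r ?nnegrE ?cmod_ge0 ?l2norm_ge0 //.
apply: le_trans (cmod_dot_le _ _) _.
by rewrite ler_piMr ?l2norm_ge0.
Qed.

Lemma l2norm_mul_le m n (B : 'M[C]_(m, n)) (v : 'cV[C]_n) :
  l2norm (B *m v) <= spectral_norm B * l2norm v.
Proof.
have [->|v0] := eqVneq v 0; first by rewrite mulmx0 !l2norm0 mulr0.
have vn : 0 < l2norm v by rewrite l2norm_gt0.
rewrite -ler_pdivrMr //; apply: ub_le_sup; first exact: spectral_norm_ub.
exists (((l2norm v)^-1)%:C *: v) => /=.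
  by rewrite l2normZ cmodR ger0_norm ?invr_ge0 ?mulVf ?gt_eqF // ltW.
by rewrite -scalemxAr l2normZ cmodR ger0_norm ?invr_ge0 1?mulrC // ltW.
Qed.

Lemma spectral_norm_ge0 m n (B : 'M[C]_(m, n)) : 0 <= spectral_norm B.
Proof.
apply: ub_le_sup; first exact: spectral_norm_ub.
by exists 0 => /=; rewrite ?mulmx0 l2norm0 // ler01.
Qed.

End L2norm.

(** * Perturbation of the noise space *)

Section Kernel.
Variable F : fieldType.

Lemma exists_ker_vector p q (M : 'M[F]_(p, q)) : (p < q)%N ->
  exists2 c : 'cV[F]_q, c != 0 & M *m c = 0.
Proof.
move=> pq; have k0 : kermx M^T != 0.
  rewrite -mxrank_eq0 mxrank_ker -lt0n subn_gt0.
  exact: leq_ltn_trans (rank_leq_col _) pq.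
have [v /sub_kermxP vM v0] := rowV0Pn k0.
exists v^T; first by rewrite -trmx0 (inj_eq trmx_inj).
by rewrite -[M]trmxK -trmx_mul vM trmx0.
Qed.

Lemma unitmx_of_ker0 p (M : 'M[F]_p) :
  (forall c : 'cV[F]_p, M *m c = 0 -> c = 0) -> M \in unitmx.
Proof.
move=> Minj; rewrite -unitmx_tr -row_free_unit -kermx_eq0.
apply/negP => /negP/rowV0Pn[v /sub_kermxP vM]; apply/negP; rewrite negbK.
have /Minj/eqP : M *m v^T = 0 by rewrite -[M]trmxK -trmx_mul vM trmx0.
by rewrite -trmx0 (inj_eq trmx_inj).
Qed.

End Kernel.

(** * Rectangular diagonal matrices *)

Section DiagonalAction.
Variables (R : realType) (m n : nat) (Sigma : 'M[R]_(m, n)).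
Hypotheses (Sdiag : is_diag_mx Sigma) (Sge0 : forall i j, 0 <= Sigma i j).
Local Notation D := (map_mx (real_complex R) Sigma).

(** A row of a rectangular diagonal matrix has at most one nonzero entry, and possibly no diagonal
    entry at all, so the square passes inside the sum over columns. *)
Lemma diag_mul_sq (P : pred 'I_m) (z : 'cV[R[i]]_n) :
  \sum_(i | P i) cmod ((D *m z) i 0) ^+ 2 =
  \sum_j (\sum_(i | P i) Sigma i j ^+ 2) * cmod (z j 0) ^+ 2.
Proof.
under [RHS]eq_bigr => j _ do rewrite big_distrl.
rewrite [RHS]exchange_big /=; apply: eq_bigr => i _; rewrite mxE.
have S0 (j : 'I_n) : i != j :> nat -> Sigma i j = 0 by move/is_diag_mxP: Sdiag;
  apply.
have [[j /eqP ij]|noj] := pselect (exists j : 'I_n, i == j :> nat).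
  have ne (k : 'I_n) : k != j -> i != k :> nat.
    by move=> kj; rewrite ij eq_sym.
  rewrite (bigD1 j) //= [RHS](bigD1 j) //= !big1 ?addr0 => [|k /ne/S0|k /ne/S0].
  - by rewrite mxE cmodM cmodR ger0_norm // exprMn.
  - by move=> ->; rewrite expr0n mul0r.
  - by move=> e; rewrite mxE e rmorph0 mul0r.
have S0' j : Sigma i j = 0.
  by apply: S0; apply/negP => ij; apply: noj; exists j.
rewrite !big1 ?cmod0 ?expr0n // => j _; first by rewrite S0' expr0n mul0r.
by rewrite mxE S0' rmorph0 mul0r.
Qed.

Lemma col_diag_sq_le (P : pred 'I_m) (j : 'I_n) t : 0 <= t ->
  (forall i, P i -> Sigma i j <= t) -> \sum_(i | P i) Sigma i j ^+ 2 <= t ^+ 2.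
Proof.
move=> t0 le_t.
have [[i /eqP ij]|noi] := pselect (exists i : 'I_m, i == j :> nat); last first.
  rewrite big1 ?sqr_ge0 // => i _; apply/eqP; rewrite sqrf_eq0; apply/eqP.
  move/is_diag_mxP: Sdiag; apply; apply/negP => ij; apply: noi; by exists i.
have z0 k : k != i -> Sigma k j = 0.
  move=> ki; move/is_diag_mxP: Sdiag; apply; apply: contra ki => /eqP kj.
  by apply/eqP/val_inj; rewrite /= ij.
rewrite big_mkcond (bigD1 i) //= big1 ?addr0 => [|k /z0 ->]; last first.
  by rewrite expr0n if_same.
case: ifP => [/le_t|_]; last exact: sqr_ge0.
by move=> h; rewrite lerXn2r ?nnegrE.
Qed.

(** Only the columns where [z] is nonzero are constrained, here and in [diag_mul_ge]: the Weyl
    arguments use vectors whose first or last coordinates vanish. *)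
Lemma diag_mul_le (P : pred 'I_m) (z : 'cV[R[i]]_n) t : 0 <= t ->
  (forall i j, z j 0 != 0 -> P i -> Sigma i j <= t) ->
  \sum_(i | P i) cmod ((D *m z) i 0) ^+ 2 <= (t * l2norm z) ^+ 2.
Proof.
move=> t0 le_t; rewrite diag_mul_sq exprMn l2norm_sq big_distrr /=.
apply: ler_sum => j _; have [->|zj] := eqVneq (z j 0) 0.
  by rewrite cmod0 expr0n !mulr0.
rewrite ler_wpM2r ?sqr_ge0 // col_diag_sq_le // => i Pi; exact: le_t.
Qed.

Lemma diag_mul_ge (z : 'cV[R[i]]_n) t : 0 <= t ->
  (forall j, z j 0 != 0 -> exists i, t <= Sigma i j) ->
  t * l2norm z <= l2norm (D *m z).
Proof.
move=> t0 ge_t; rewrite -(ler_pXn2r (ltn0Sn 1)) ?nnegrE ?mulr_ge0 ?l2norm_ge0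
  //.
rewrite exprMn !l2norm_sq diag_mul_sq big_distrr /=; apply: ler_sum => j _.
have [->|/ge_t[i ti]] := eqVneq (z j 0) 0; first by rewrite cmod0 expr0n !mulr0.
rewrite ler_wpM2r ?sqr_ge0 // (bigD1 i) //=.
apply: ler_wpDr; first by apply: sumr_ge0 => k _; rewrite sqr_ge0.
by rewrite lerXn2r ?nnegrE.
Qed.

End DiagonalAction.

Section BoundedBelow.
Local Open Scope sesquilinear_scope.
Variables (R : realType) (m p : nat) (B : 'M[R[i]]_(m, p)) (s : R).
Hypotheses (s_gt0 : 0 < s) (Bge : forall c, s * l2norm c <= l2norm (B *m c)).

(** |B c|^2 = <c, B* B c> <= |c| |B* B c|, and |c| <= |B c| / s. *)
Lemma adj_ge_on_range (c : 'cV[R[i]]_p) :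
  s * l2norm (B *m c) <= l2norm (B ^t* *m (B *m c)).
Proof.
set w := B *m c; have [->|w0] := eqVneq w 0.
  by rewrite mulmx0 !l2norm0 mulr0.
have wn : 0 < l2norm w by rewrite l2norm_gt0.
have h : l2norm w ^+ 2 <= l2norm c * l2norm (B ^t* *m w).
  rewrite -(ger0_norm (sqr_ge0 _)) -cmodR -dot_self {1}/w adj_mul -mulmxA.
  exact: cmod_dot_le.
rewrite -(ler_pM2l wn) mulrCA -expr2.
apply: (le_trans (ler_wpM2l (ltW s_gt0) h)); rewrite mulrA.
by rewrite ler_wpM2r ?l2norm_ge0.
Qed.

Lemma gram_ker0 (c : 'cV[R[i]]_p) : B ^t* *m (B *m c) = 0 -> c = 0.
Proof.
move=> G0; have := adj_ge_on_range c; rewrite G0 l2norm0 => h.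
have Bc0 : l2norm (B *m c) <= 0 by rewrite -(pmulr_rle0 _ s_gt0).
have := le_trans (Bge c) Bc0; rewrite pmulr_rle0 // => c0.
by apply/eqP; rewrite -l2norm_eq0 eq_le c0 l2norm_ge0.
Qed.

Lemma gram_unitmx : B ^t* *m B \in unitmx.
Proof. by apply: unitmx_of_ker0 => c; rewrite -mulmxA; exact: gram_ker0. Qed.

End BoundedBelow.

Lemma diag_mx_ge (R : realType) p (d : 'rV[R[i]]_p) dmin (y : 'cV_p) :
  0 <= dmin -> (forall j, dmin <= cmod (d 0 j)) ->
  dmin * l2norm y <= l2norm (diag_mx d *m y).
Proof.
move=> d0 dge; rewrite -(ler_pXn2r (ltn0Sn 1)) ?nnegrE ?mulr_ge0 ?l2norm_ge0 //.
rewrite exprMn !l2norm_sq big_distrr /=; apply: ler_sum => j _.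
rewrite mul_diag_mx mxE cmodM exprMn ler_wpM2r ?sqr_ge0 //.
by rewrite lerXn2r ?nnegrE ?cmod_ge0.
Qed.

Section LastColumns.
Local Open Scope sesquilinear_scope.

Lemma l2norm_last_cols_sq (R : realType) L S (U : 'M[R[i]]_L.+1)
    (v : 'cV_L.+1) :
  l2norm ((last_cols S U) ^t* *m v) ^+ 2 =
  \sum_(i < L.+1 | (S <= i)%N) cmod ((U ^t* *m v) i 0) ^+ 2.
Proof.
pose F k := cmod ((U ^t* *m v) (inord k) 0) ^+ 2.
transitivity (\sum_(S <= k < L.+1) F k).
  have -> : \sum_(S <= k < L.+1) F k = \sum_(0 <= k < L.+1 - S) F (k + S)%N.
    by rewrite -{1}[S]add0n big_addn.
  rewrite l2norm_sq big_mkord; apply: eq_bigr => j _.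
  rewrite /F !mxE; congr (cmod _ ^+ 2); apply: eq_bigr => i _.
  by rewrite !mxE addnC.
rewrite (big_nat_widenl _ 0) // big_mkord; apply: eq_big => // i _.
by rewrite /F inord_val.
Qed.

Lemma l2norm_last_cols_le (R : realType) L S (U : 'M[R[i]]_L.+1)
    (v : 'cV_L.+1) :
  U \is unitarymx -> l2norm ((last_cols S U) ^t* *m v) <= l2norm v.
Proof.
move=> UU; rewrite -(ler_pXn2r (ltn0Sn 1)) ?nnegrE ?l2norm_ge0 //.
rewrite l2norm_last_cols_sq -(l2norm_unitary_adj v UU) l2norm_sq.
rewrite [leRHS](bigID (fun i : 'I_L.+1 => S <= i)%N) /= lerDl.
exact: sum_cmod_sq_ge0.
Qed.

End LastColumns.

(** * Clean and noisy noise spaces compared *)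

Section Perturbation.
Local Open Scope sesquilinear_scope.
Variables (R : realType) (L N S : nat).
Hypotheses (S_gt0 : (0 < S)%N) (SL : (S <= L)%N) (SN : (S <= N)%N).
Variables (A : 'M[R[i]]_(L.+1, S)) (d : 'rV[R[i]]_S) (B : 'M[R[i]]_(N.+1, S)).
Variables (s dmin e : R) (E : 'M[R[i]]_(L.+1, N.+1)).
Hypotheses (s_gt0 : 0 < s) (dmin_gt0 : 0 < dmin).
Hypothesis Age : forall c, s * l2norm c <= l2norm (A *m c).
Hypothesis Bge : forall c, s * l2norm c <= l2norm (B *m c).
Hypothesis dge : forall j, dmin <= cmod (d 0 j).
Hypothesis Ele : forall v, l2norm (E *m v) <= e * l2norm v.
Hypothesis e_ge0 : 0 <= e.
(** The clean data matrix. [B] will be the conjugate of a Fourier matrix, so that its adjoint is a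
    transpose, and [sigma] bounds the S-th singular value of [H0] from below. *)
Local Notation H0 := (A *m diag_mx d *m B ^t*).
Local Notation H := (H0 + E).
Local Notation sigma := (dmin * s ^+ 2).
Hypothesis e_lt : 2 * e < sigma.
Variables (U : 'M[R[i]]_L.+1) (Sigma : 'M[R]_(L.+1, N.+1)) (V : 'M[R[i]]_N.+1).
Hypothesis Hsvd : is_svd H U Sigma V.
Local Notation D := (map_mx (real_complex R) Sigma).
Variables (k : nat) (W : 'M[R[i]]_(L.+1, k)).
Hypothesis HW : orthobasis_range_perp H0 W.

Let UU : U \is unitarymx. Proof. by case: Hsvd => -[]. Qed.
Let VV : V \is unitarymx. Proof. by case: Hsvd => -[]. Qed.
Let Sdiag : is_diag_mx Sigma. Proof. by case: Hsvd. Qed.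
Let Sge0 i j : 0 <= Sigma i j. Proof. by case: Hsvd. Qed.
Let HE : H = U *m D *m V ^t*. Proof. by case: Hsvd. Qed.

(** Indices start at 0: [tau] is the (S+1)st singular value of [H] and [rho] the S-th. *)
Local Notation tau := (Sigma (inord S) (inord S)).
Local Notation rho := (Sigma (inord S.-1) (inord S.-1)).

(** Off-diagonal entries are 0, so a lower bound on either index suffices. *)
Let sv_le (i : 'I_L.+1) (j : 'I_N.+1) (l : nat) :
  (l <= L)%N -> (l <= N)%N -> (l <= i)%N \/ (l <= j)%N ->
  Sigma i j <= Sigma (inord l) (inord l).
Proof.
move=> lL lN lij; have [ij|ij] := eqVneq (i : nat) (j : nat); last first.
  by rewrite (is_diag_mxP Sdiag _ _ ij).
case: Hsvd => _ _ _ dec _; apply: dec => //; rewrite ?inordK ?ltnS //.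
by case: lij; rewrite ?ij.
Qed.

Let sv_ge (i : 'I_L.+1) (j : 'I_N.+1) (l : nat) :
  (l <= L)%N -> (l <= N)%N -> i = j :> nat ->
  (i <= l)%N -> Sigma (inord l) (inord l) <= Sigma i j.
Proof.
move=> lL lN ij il; case: Hsvd => _ _ _ dec _; apply: dec => //.
  by rewrite !inordK ?ltnS.
by rewrite inordK ?ltnS.
Qed.

Let adjV_mulK (z : 'cV_N.+1) : V ^t* *m (V *m z) = z.
Proof. by rewrite mulmxA (mulmx1C (unitarymxP VV)) mul1mx. Qed.

Let adjU_mulK (z : 'cV_L.+1) : U ^t* *m (U *m z) = z.
Proof. by rewrite mulmxA (mulmx1C (unitarymxP UU)) mul1mx. Qed.

Let adjU_H (w : 'cV_N.+1) : U ^t* *m (H *m w) = D *m (V ^t* *m w).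
Proof. by rewrite HE -!mulmxA adjU_mulK. Qed.

Let norm_H (w : 'cV_N.+1) : l2norm (H *m w) = l2norm (D *m (V ^t* *m w)).
Proof. by rewrite -adjU_H l2norm_unitary_adj. Qed.

(* Weyl's inequality for the (S+1)st singular value: [H0] kills a nonzero
   combination of the first S+1 right singular vectors of [H]. *)
Let tau_le : tau <= e.
Proof.
(* N equations in N+1 unknowns: S of them put [V *m z] in the kernel of the adjoint of [B], the
   other N - S make the coordinates of [z] beyond index S vanish. *)
pose M : 'M[R[i]]_(S + (N - S), N.+1) := col_mx (B ^t* *m V)
  (\matrix_(l < N - S, j < N.+1) ((j == (S.+1 + l)%N :> nat)%:R)).
have [z z0 Mz] : exists2 z : 'cV_N.+1, z != 0 & M *m z = 0.
  by apply: exists_ker_vector; rewrite subnKC.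
move: Mz; rewrite mul_col_mx -col_mx0 => /eq_col_mx[Bz Kz].
have zj0 (j : 'I_N.+1) : (S < j)%N -> z j 0 = 0.
  move=> Sj; have lt : (j - S.+1 < N - S)%N.
    by have := ltn_ord j; lia.
  move/colP/(_ (Ordinal lt)): Kz; rewrite !mxE (bigD1 j) //= big1 ?addr0.
    by rewrite mxE /= subnKC // eqxx mul1r.
  by move=> l lj; rewrite mxE /= subnKC // -(inj_eq val_inj) /= in lj *;
    rewrite (negPf lj) mul0r.
have zn : 0 < l2norm z by rewrite l2norm_gt0.
rewrite -(ler_pM2r zn).
have -> : l2norm z = l2norm (V *m z) by rewrite l2norm_unitary.
apply: le_trans (Ele _).
have -> : E *m (V *m z) = H *m (V *m z).
  by rewrite mulmxDl -!mulmxA (mulmxA (_ ^t*) V) Bz !mulmx0 add0r.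
rewrite norm_H adjV_mulK l2norm_unitary //.
apply: (diag_mul_ge Sdiag Sge0) => // j zj.
have jS : (j <= S)%N by rewrite leqNgt; apply/negP => /zj0 /eqP;
  rewrite (negPf zj).
have jL : (j < L.+1)%N by rewrite ltnS (leq_trans jS).
by exists (inord j); apply: sv_ge; rewrite ?inordK.
Qed.

(** [sigma] is the product of the lower bounds of [A], of the diagonal matrix and of the adjoint of
    [B] on the range of [B]. *)
Let H0_ge (c : 'cV_S) : sigma * l2norm (B *m c) <= l2norm (H0 *m (B *m c)).
Proof.
rewrite -!mulmxA; apply: le_trans (Age _); rewrite (mulmxA (B ^t*)) -mulmxA.
rewrite [sigma]mulrC expr2 -!mulrA ler_pM2l // mulrCA.
apply: le_trans (diag_mx_ge _ (ltW dmin_gt0) dge); rewrite ler_pM2l //.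
exact: adj_ge_on_range.
Qed.

(** Weyl's inequality from the other side: the range of [B] has dimension S, hence contains a
    nonzero [w] orthogonal to the first S-1 right singular vectors. On it [H] stretches by at most
    [rho] and at least sigma - e, which exceeds sigma/2. *)
Let half_sigma_le_rho : sigma / 2 <= rho.
Proof.
pose M : 'M[R[i]]_(S.-1, S) := \matrix_(l < S.-1, j < S)
  (V ^t* *m B) (inord l) j.
have [c c0 Mc] : exists2 c : 'cV_S, c != 0 & M *m c = 0.
  by apply: exists_ker_vector; rewrite prednK.
set w := B *m c; set z := V ^t* *m w.
have zj0 (j : 'I_N.+1) : (j < S.-1)%N -> z j 0 = 0.
  move=> jS; have : (M *m c) (Ordinal jS) 0 = 0 by rewrite Mc mxE.
  rewrite mxE => <-; rewrite /z /w mulmxA mxE; apply: eq_bigr => l _.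
  by congr (_ * _); rewrite [in RHS]mxE /= inord_val.
have wn : 0 < l2norm w.
  by apply: lt_le_trans (Bge _); rewrite mulr_gt0 // l2norm_gt0.
have S1 l : (S <= l -> S.-1 <= l)%N by apply: leq_trans; exact: leq_pred.
have h1 : l2norm (H *m w) <= rho * l2norm w.
  rewrite norm_H -(l2norm_unitary_adj w VV); apply: le_l2norm.
    by rewrite mulr_ge0 ?l2norm_ge0.
  apply: (diag_mul_le Sdiag Sge0) => // i j zj _;
    apply: (sv_le (S1 _ SL) (S1 _ SN)).
  by right; rewrite leqNgt; apply/negP => /zj0/eqP; rewrite (negPf zj).
have h2 : sigma * l2norm w <= l2norm (H *m w) + e * l2norm w.
  apply: le_trans (H0_ge c) _; rewrite -/w.
  have -> : H0 *m w = H *m w - E *m w by rewrite mulmxDl addrK.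
  by apply: le_trans (l2normD _ _) _; rewrite l2normN lerD2l.
have : sigma <= rho + e by rewrite -(ler_pM2r wn) mulrDl; apply: le_trans h2 _;
  rewrite lerD2r.
move: e_lt (rho) => lt1 r lt2; lra.
Qed.

(** On the range of [B], [H0] acts as [A] after the diagonal matrix times the Gram matrix of [B],
    which is invertible. Preimages taken in the range of [B] are controlled by [H0_ge]. *)
Let range_A (b : 'cV_S) : exists c : 'cV_S, H0 *m (B *m c) = A *m b.
Proof.
have G : diag_mx d *m (B ^t* *m B) \in unitmx.
  apply: unitmx_of_ker0 => c Gc; apply: (gram_ker0 s_gt0 Bge).
  apply/eqP; rewrite -l2norm_eq0 eq_le l2norm_ge0 andbT -(pmulr_rle0 _
    dmin_gt0).
  apply: le_trans (diag_mx_ge _ (ltW dmin_gt0) dge) _.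
  by rewrite (mulmxA (B ^t*)) mulmxA Gc l2norm0.
exists (invmx (diag_mx d *m (B ^t* *m B)) *m b).
by rewrite -!mulmxA (mulmxA (B ^t*)) (mulmxA (diag_mx d)) mulKVmx.
Qed.

Let WW : W ^t* *m W = 1%:M. Proof. by case: HW. Qed.

(** The square norm of v = W* H0 w is the pairing of H0 w with W v, and W v is orthogonal to the
    range of [H0]. *)
Let adjW_H0 (w : 'cV_N.+1) : W ^t* *m (H0 *m w) = 0.
Proof.
case: HW => _ hW; set v := W ^t* *m (H0 *m w).
have /hW/(_ w) h : exists c, W *m v = W *m c by exists v.
have : (v ^t* *m v) 0 0 = 0.
  have -> : v ^t* *m v = (H0 *m w) ^t* *m (W *m v).
    by rewrite {1}/v (adj_mul (W ^t*)) adjK -(mulmxA _ W).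
  by rewrite h mxE.
rewrite dot_self => /(congr1 (@complex.Re R)) /= /eqP;
  rewrite sqrf_eq0 l2norm_eq0.
by move/eqP.
Qed.

Lemma last_cols_corr_le (phi : 'cV_L.+1) :
  l2norm ((last_cols S U) ^t* *m phi) <=
  l2norm (W ^t* *m phi) + 2 * e / sigma * l2norm phi.
Proof.
(* The normal equations make [A *m b] the orthogonal projection of [phi] on the clean signal space;
   the rest [r] lies in the clean noise space. *)
set b := invmx (A ^t* *m A) *m (A ^t* *m phi); set r := phi - A *m b.
have Ar : A ^t* *m r = 0.
  by rewrite mulmxBr !mulmxA mulmxV ?mul1mx ?subrr // (gram_unitmx s_gt0).
have [c0 rW] : exists c, r = W *m c.
  case: HW => _ hW; apply/hW => u.
  by rewrite !adj_mul -!mulmxA Ar !mulmx0.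
have [c Ab] := range_A b; set w := B *m c in Ab.
have phiE : phi = r + A *m b by rewrite subrK.
have c0E : W ^t* *m phi = c0.
  by rewrite phiE mulmxDr -Ab adjW_H0 addr0 rW mulmxA WW mul1mx.
have Abn : l2norm (A *m b) <= l2norm phi.
  have [->|u0] := eqVneq (A *m b) 0; first by rewrite l2norm0 l2norm_ge0.
  have un : 0 < l2norm (A *m b) by rewrite l2norm_gt0.
  rewrite -(ler_pM2l un) -expr2 -(ger0_norm (sqr_ge0 _)) -cmodR -dot_self.
  have : (A *m b) ^t* *m r = 0 by rewrite adj_mul -mulmxA Ar mulmx0.
  rewrite /r mulmxBr => /eqP; rewrite subr_eq0 => /eqP <-.
  exact: cmod_dot_le.
have sigma_gt0 : 0 < sigma by rewrite mulr_gt0 ?exprn_gt0.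
have wn : l2norm w <= l2norm phi / sigma.
  by rewrite ler_pdivlMr // mulrC; apply: le_trans Abn; rewrite -Ab H0_ge.
rewrite {1}phiE mulmxDr; apply: le_trans (l2normD _ _) _; apply: lerD.
  apply: le_trans (l2norm_last_cols_le _ _ UU) _.
  by rewrite rW (l2norm_isometry _ WW) c0E.
(* The last coordinates of H w are damped by singular values of at most [tau], hence by [e], and E w
   is at most e |w|: together 2 e |w|. *)
have -> : A *m b = H *m w - E *m w by rewrite mulmxDl addrK Ab.
rewrite mulmxBr; apply: le_trans (l2normD _ _) _; rewrite l2normN.
have h1 : l2norm ((last_cols S U) ^t* *m (H *m w)) <= e * l2norm w.
  rewrite -(ler_pXn2r (ltn0Sn 1)) ?nnegrE ?mulr_ge0 ?l2norm_ge0 //.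
  rewrite l2norm_last_cols_sq adjU_H -(l2norm_unitary_adj w VV).
  apply: (diag_mul_le Sdiag Sge0) => // i j _ Si; apply: le_trans tau_le.
  by apply: sv_le => //; left.
have h2 : l2norm ((last_cols S U) ^t* *m (E *m w)) <= e * l2norm w.
  by apply: le_trans (l2norm_last_cols_le _ _ UU) _.
apply: le_trans (lerD h1 h2) _.
have -> : 2 * e / sigma * l2norm phi = 2 * e * (l2norm phi / sigma) by ring.
have -> : e * l2norm w + e * l2norm w = 2 * e * l2norm w by ring.
by rewrite ler_wpM2l // mulr_ge0.
Qed.

Lemma corr_le_last_cols (phi : 'cV_L.+1) : l2norm (W ^t* *m phi) <=
  l2norm ((last_cols S U) ^t* *m phi) + 2 * e / sigma * l2norm phi.
Proof.
have sigma_gt0 : 0 < sigma by rewrite mulr_gt0 ?exprn_gt0.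
have rho_gt0 : 0 < rho by apply: lt_le_trans half_sigma_le_rho;
  rewrite divr_gt0.
have S1L : (S.-1 <= L)%N by apply: leq_trans SL; exact: leq_pred.
have S1N : (S.-1 <= N)%N by apply: leq_trans SN; exact: leq_pred.
have ltS (j : nat) : (j < S)%N = (j <= S.-1)%N
  by rewrite -{1}(prednK S_gt0) ltnS.
have sv_gt0 (j : 'I_N.+1) : (j < S)%N -> rho <= Sigma (inord j) j.
  move=> jS; have jE : (inord j : 'I_L.+1) = j :> nat.
    by rewrite inordK // ltnS (leq_trans (ltnW jS)).
  by apply: sv_ge => //; rewrite jE -?ltS.
pose f := U ^t* *m phi.
(* Coordinates of a preimage under [H] of the projection of [phi] on the first S left singular
   vectors; the singular values divided by are at least [rho]. *)
pose z : 'cV[R[i]]_N.+1 := \col_(j < N.+1)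
  if (j < S)%N then f (inord j) 0 / (Sigma (inord j) j)%:C else 0.
have Dz (i : 'I_L.+1) : (D *m z) i 0 = if (i < S)%N then f i 0 else 0.
  rewrite mxE; case: ifP => iS; last first.
    rewrite big1 // => j _; rewrite !mxE; case: ifP => jS;
      last by rewrite mulr0.
    rewrite (is_diag_mxP Sdiag) ?rmorph0 ?mul0r //.
    by apply: contraFN iS => /eqP ->.
  have iN : (i < N.+1)%N by rewrite ltnS (leq_trans (ltnW iS)).
  rewrite (bigD1 (Ordinal iN)) //= big1 ?addr0.
    rewrite !mxE /= iS inord_val mulrCA divff ?mulr1 //.
    rewrite fmorph_eq0 gt_eqF // (lt_le_trans rho_gt0) //.
    by have := sv_gt0 (Ordinal iN) iS; rewrite /= inord_val.
  move=> j ji; rewrite mxE (is_diag_mxP Sdiag) ?rmorph0 ?mul0r //.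
  by apply: contra ji => /eqP ij; apply/eqP/val_inj; rewrite /= ij.
set w := V *m z; set u := H *m w.
have Uu : U ^t* *m u = D *m z by rewrite adjU_H adjV_mulK.
have un : l2norm u <= l2norm phi.
  rewrite norm_H adjV_mulK -(l2norm_unitary_adj phi UU); apply: le_l2norm.
    exact: l2norm_ge0.
  rewrite l2norm_sq; apply: ler_sum => i _; rewrite Dz.
  by case: ifP => // _; rewrite cmod0 expr0n sqr_ge0.
have zn : rho * l2norm z <= l2norm u.
  rewrite norm_H adjV_mulK; apply: (diag_mul_ge Sdiag Sge0) => // j.
  rewrite mxE; case: ifP => jS; last by rewrite eqxx.
  by move=> _; exists (inord j); exact: sv_gt0.
have ru : l2norm (phi - u) = l2norm ((last_cols S U) ^t* *m phi).
  apply/eqP; rewrite -(eqrXn2 (ltn0Sn 1)) ?l2norm_ge0 //; apply/eqP.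
  rewrite l2norm_last_cols_sq -(l2norm_unitary_adj _ UU) l2norm_sq mulmxBr Uu.
  rewrite [RHS]big_mkcond; apply: eq_bigr => i _.
  rewrite [in LHS]mxE [X in cmod (_ + X)]mxE Dz [(S <= i)%N]leqNgt -/f.
  by case: ifP => _ /=; rewrite ?subrr ?subr0 ?cmod0 ?expr0n.
have phiE : phi = (phi - u) + u by rewrite subrK.
rewrite {1}phiE mulmxDr; apply: le_trans (l2normD _ _) _; apply: lerD.
  by rewrite -ru; exact: l2norm_coisometry_le.
(* The clean part of u = H w is killed by the adjoint of [W], which leaves only the noise E w. *)
rewrite /u mulmxDl mulmxDr adjW_H0 add0r.
apply: le_trans (l2norm_coisometry_le _ WW) _; apply: le_trans (Ele _) _.
rewrite l2norm_unitary //.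
have : sigma / 2 * l2norm z <= l2norm phi.
  apply: le_trans un; apply: le_trans zn.
  by rewrite ler_wpM2r ?l2norm_ge0 ?half_sigma_le_rho.
have -> : 2 * e / sigma * l2norm phi = e * (l2norm phi / (sigma / 2)).
  by field; rewrite !gt_eqF.
by move=> h; rewrite ler_wpM2l // ler_pdivlMr ?divr_gt0 // mulrC.
Qed.

End Perturbation.

(** * Interpolation by polynomials on the unit circle *)

Section CoefficientNorm.
Variables (R : realType) (n : nat).
Local Notation C := R[i].
Implicit Types p : {poly C}.

(* Only the coefficients below [n] are counted, so that multiplication by ['X]
   is a contraction. *)
Definition coef_norm p : R := l2norm (\col_(i < n) p`_i).

Lemma coef_norm_ge0 p : 0 <= coef_norm p.
Proof. exact: l2norm_ge0. Qed.

Lemma coef_normD p (q : {poly C}) :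
  coef_norm (p + q) <= coef_norm p + coef_norm q.
Proof.
apply: le_trans (l2normD _ _); rewrite le_eqVlt; apply/orP; left; apply/eqP;
  congr l2norm.
by apply/colP => i; rewrite !mxE coefD.
Qed.

Lemma coef_normZ a p : coef_norm (a *: p) = cmod a * coef_norm p.
Proof.
rewrite /coef_norm -l2normZ; congr l2norm.
by apply/colP => i; rewrite !mxE coefZ.
Qed.

Lemma coef_norm0 : coef_norm 0 = 0.
Proof. by rewrite -(scale0r 0) coef_normZ cmod0 mul0r. Qed.

Lemma coef_norm_sum (I : Type) (r : seq I) (P : pred I) (F : I -> {poly C}) :
  coef_norm (\sum_(i <- r | P i) F i) <= \sum_(i <- r | P i) coef_norm (F i).
Proof.
elim/big_rec2: _ => [|i y z _ le]; first by rewrite coef_norm0.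
by apply: le_trans (coef_normD _ _) _; rewrite lerD2l.
Qed.

Lemma coef_normXnM k p : coef_norm ('X^k * p) <= coef_norm p.
Proof.
apply: le_l2norm; first exact: coef_norm_ge0.
rewrite l2norm_sq; under eq_bigr => i _ do rewrite mxE coefXnM.
under [leRHS]eq_bigr => i _ do rewrite mxE.
rewrite -(big_mkord predT (fun i =>
  cmod (if (i < k)%N then 0 else p`_(i - k)) ^+ 2)).
rewrite -(big_mkord predT (fun i => cmod p`_i ^+ 2)).
have F0 (F : nat -> C) a b : 0 <= \sum_(a <= i < b) cmod (F i) ^+ 2.
  by apply: sumr_ge0 => i _; rewrite sqr_ge0.
have [nk|kn] := leqP n k.
  rewrite big_nat big1 // => i /andP[_ ltin].
  by rewrite (leq_trans ltin nk) cmod0 expr0n.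
rewrite (big_cat_nat (leq0n k) (ltnW kn)) /= big_nat big1 => [|i /andP[_ ->]];
  last first.
  by rewrite cmod0 expr0n.
rewrite add0r -{1}(add0n k) big_addn.
rewrite (big_cat_nat (leq0n (n - k)) (leq_subr k n)) /= -[leLHS]addr0 lerD //.
rewrite big_nat [leRHS]big_nat; apply: ler_sum => i _.
by rewrite ltnNge leq_addl addnK.
Qed.

Lemma coef_norm_XnsubC k w p : cmod w = 1 ->
  coef_norm (('X^k - w%:P) * p) <= 2 * coef_norm p.
Proof.
move=> w1; rewrite mulrBl -scaleN1r mul_polyC.
apply: le_trans (coef_normD _ _) _.
rewrite !coef_normZ cmodN cmod1 w1 !mul1r mulr2n mulrDl mul1r.
by rewrite lerD2r coef_normXnM.
Qed.

Lemma coef_norm_prod_XnsubC k (I : Type) (r : seq I) (P : pred I)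
    (w b : I -> C) p : (forall i, P i -> cmod (w i) = 1) ->
  coef_norm (\prod_(i <- r | P i) ((b i)^-1 *: ('X^k - (w i)%:P)) * p) <=
  \prod_(i <- r | P i) (2 / cmod (b i)) * coef_norm p.
Proof.
move=> w1; elim/big_rec2: _ => [|i c a Pi le]; first by rewrite !mul1r.
have h : coef_norm (('X^k - (w i)%:P) * (a * p)) <= 2 * (c * coef_norm p).
  by apply: le_trans (coef_norm_XnsubC _ _ (w1 _ Pi)) _; rewrite ler_wpM2l.
have -> : 2 / cmod (b i) * c * coef_norm p =
    (cmod (b i))^-1 * (2 * (c * coef_norm p)) by ring.
rewrite -[_ * a * p]mulrA -scalerAl coef_normZ cmodV.
by rewrite ler_wpM2l ?invr_ge0 ?cmod_ge0.
Qed.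

(* The Dirichlet kernel of degree [q], normalized and translated to the point
   [u^-1] of the unit circle. *)
Definition dirichlet (q : nat) (u : C) : {poly C} :=
  \sum_(i < q.+1) (u ^+ i / q.+1%:R) *: 'X^i.

Lemma coef_dirichlet q u (i : nat) :
  (dirichlet q u)`_i = if (i < q.+1)%N then u ^+ i / q.+1%:R else 0.
Proof.
rewrite /dirichlet -(poly_def q.+1 (fun i => u ^+ i / q.+1%:R)) coef_poly.
by [].
Qed.

Lemma size_dirichlet q u : (size (dirichlet q u) <= q.+1)%N.
Proof.
by apply/leq_sizeP => i qi; rewrite coef_dirichlet ltnNge qi.
Qed.

Lemma cmod_dirichlet_coef (q : nat) (u : C) (i : nat) : cmod u = 1 ->
  cmod (u ^+ i / q.+1%:R) = q.+1%:R^-1 :> R.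
Proof. by move=> u1; rewrite cmodM cmodX u1 expr1n mul1r cmodV cmod_nat. Qed.

(** The kernel is an average of shifts multiplied by unimodular numbers, and shifts are
    contractions. *)
Lemma coef_norm_dirichletM q u p : cmod u = 1 ->
  coef_norm (dirichlet q u * p) <= coef_norm p.
Proof.
move=> u1; rewrite big_distrl; apply: le_trans (coef_norm_sum _ _ _) _.
apply: (@le_trans _ _ (\sum_(i < q.+1) q.+1%:R^-1 * coef_norm p)).
  apply: ler_sum => i _; rewrite /= -scalerAl coef_normZ cmod_dirichlet_coef //.
  by rewrite ler_wpM2l ?invr_ge0 ?ler0n // coef_normXnM.
by rewrite sumr_const card_ord -[_ *+ _]mulr_natl mulrA divff ?mul1r ?pnatr_eq0.
Qed.

Lemma coef_norm_dirichlet q u : cmod u = 1 ->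
  coef_norm (dirichlet q u) <= (Num.sqrt q.+1%:R)^-1.
Proof.
move=> u1; apply: le_l2norm; first by rewrite invr_ge0 sqrtr_ge0.
rewrite exprVn sqr_sqrtr ?ler0n //.
pose F i : R := cmod (dirichlet q u)`_i ^+ 2.
have FE i : F i = if (i < q.+1)%N then q.+1%:R^-1 ^+ 2 else 0.
  rewrite /F coef_dirichlet; case: ifP => _; last by rewrite cmod0 expr0n.
  by rewrite cmod_dirichlet_coef.
rewrite (eq_bigr (fun i : 'I_n => F i)) => [|i _]; last by rewrite mxE.
rewrite -(big_mkord predT F) (eq_bigr _ (fun i _ => FE i)) -big_mkcond /=.
apply: (@le_trans _ _ (\sum_(0 <= i < q.+1) q.+1%:R^-1 ^+ 2)); last first.
  rewrite sumr_const_nat subn0 -[_ *+ _]mulr_natl expr2 mulrA.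
  by rewrite divff ?mul1r ?pnatr_eq0.
rewrite (big_nat_widen _ _ _ _ _ (leq_addr q.+1 n)).
rewrite [leRHS](big_nat_widen _ _ _ _ _ (leq_addl n q.+1)).
rewrite big_mkcond [leRHS]big_mkcond; apply: ler_sum => i _.
by case: (i < q.+1)%N; case: (i < n)%N => //=; rewrite sqr_ge0.
Qed.

(** One factor supplies the decay in [q]; the remaining [r] factors are contractions. *)
Lemma coef_norm_dirichletX q u r : cmod u = 1 ->
  coef_norm (dirichlet q u ^+ r.+1) <= (Num.sqrt q.+1%:R)^-1.
Proof.
move=> u1; elim: r => [|r IH]; first exact: coef_norm_dirichlet.
by rewrite exprS; apply: le_trans (coef_norm_dirichletM _ _ _) IH.
Qed.

Lemma horner_dirichlet q u z :
  (dirichlet q u).[z] = (\sum_(i < q.+1) (u * z) ^+ i) / q.+1%:R.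
Proof.
rewrite horner_sum mulr_suml; apply: eq_bigr => i _.
by rewrite hornerZ hornerXn exprMn mulrAC.
Qed.

Lemma horner_dirichlet1 q u z : u * z = 1 -> (dirichlet q u).[z] = 1.
Proof.
move=> uz; rewrite horner_dirichlet uz; under eq_bigr => i _ do rewrite expr1n.
by rewrite sumr_const card_ord divff // pnatr_eq0.
Qed.

End CoefficientNorm.

(** * From interpolating polynomials to a lower bound, by duality *)

Section Duality.
Variables (R : realType) (n S : nat) (z : 'I_S -> R[i]) (p : 'I_S -> {poly
  R[i]}).
Variables (e : 'I_S -> 'I_S -> R) (eps K : R).
Hypothesis size_p : forall j, (size (p j) <= n)%N.
Hypothesis p_interp : forall k j, cmod ((p j).[z k] - (k == j)%:R) <= e k j.
Hypothesis e_row : forall k, \sum_j e k j <= eps.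
Hypothesis e_col : forall j, \sum_k e k j <= eps.
Hypothesis K_ge0 : 0 <= K.
Hypothesis p_norm : \sum_j coef_norm n (p j) ^+ 2 <= K ^+ 2.

(** Its value at [z k] is close to the conjugate of [v k 0], so that pairing [v] with these values
    nearly gives the square norm of [v]. *)
Let P (v : 'cV[R[i]]_S) : {poly R[i]} := \sum_j (v j 0)^*%R *: p j.

Let P_norm (v : 'cV_S) : coef_norm n (P v) <= l2norm v * K.
Proof.
apply: le_trans (coef_norm_sum _ _ _ _) _.
under eq_bigr => j _ do rewrite coef_normZ cmod_conj.
apply: le_trans (cauchy_schwarz_sqrt _ _) _.
rewrite ler_wpM2l ?sqrtr_ge0 // -(ger0_norm K_ge0) -sqrtr_sqr.
by rewrite ler_sqrt ?sqr_ge0.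
Qed.

Let P_pairing (v : 'cV_S) : \sum_k v k 0 * (P v).[z k] =
  \sum_(m < n) (P v)`_m * ((\matrix_(m < n, j < S) z j ^+ m) *m v) m 0.
Proof.
have sP : (size (P v) <= n)%N.
  apply: leq_trans (size_sum _ _ _) _; apply/bigmax_leqP => j _.
  exact: leq_trans (size_scale_leq _ _) (size_p j).
under eq_bigr => k _ do rewrite (horner_coef_wide _ sP) big_distrr.
rewrite exchange_big /=; apply: eq_bigr => m _.
rewrite mxE big_distrr; apply: eq_bigr => k _.
by rewrite mxE /= mulrCA [v k 0 * _]mulrC.
Qed.

Let P_value (v : 'cV_S) : l2norm v ^+ 2 - eps * l2norm v ^+ 2 <=
  cmod (\sum_k v k 0 * (P v).[z k]).
Proof.
have e_ge0 k j : 0 <= e k j by apply: le_trans (cmod_ge0 _) (p_interp k j).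
pose d := \sum_k \sum_j v k 0 * (v j 0)^*%R * ((p j).[z k] - (k == j)%:R).
have E : \sum_k v k 0 * (P v).[z k] = (l2norm v ^+ 2)%:C + d.
  rewrite l2norm_sq rmorph_sum -big_split; apply: eq_bigr => k _.
  rewrite /= cmod_sq /P horner_sum big_distrr /=.
  transitivity (\sum_j (v k 0 * (v j 0)^*%R * (k == j)%:R +
      v k 0 * (v j 0)^*%R * ((p j).[z k] - (k == j)%:R))).
    by apply: eq_bigr => j _; rewrite hornerZ; ring.
  rewrite big_split /= (bigD1 k) //= eqxx big1 ?addr0 => [|j jk].
    by rewrite mulr1 mulrC.
  by rewrite eq_sym (negPf jk) mulr0.
have d_le : cmod d <= eps * l2norm v ^+ 2.
  pose a k := cmod (v k 0).
  (* Schur's test: the arithmetic-geometric inequality splits the double sum into one part governed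
     by the row sums of [e] and one by its column sums. *)
  apply: (@le_trans _ _ (\sum_k \sum_j e k j * ((a k ^+ 2 + a j ^+ 2) / 2))).
    apply: le_trans (cmod_sum _ _ _) _; apply: ler_sum => k _.
    apply: le_trans (cmod_sum _ _ _) _; apply: ler_sum => j _.
    rewrite 2!cmodM cmod_conj mulrC -/(a k) -/(a j).
    apply: ler_pM => //; rewrite ?mulr_ge0 ?cmod_ge0 //.
    by rewrite -subr_ge0; have := sqr_ge0 (a k - a j); lra.
  have -> : \sum_k \sum_j e k j * ((a k ^+ 2 + a j ^+ 2) / 2) =
      (\sum_k (\sum_j e k j) * a k ^+ 2 + \sum_j (\sum_k e k j) * a j ^+ 2) / 2.
    have -> : \sum_k (\sum_j e k j) * a k ^+ 2 = \sum_k \sum_j e k j * a k ^+ 2.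
      by apply: eq_bigr => k _; rewrite mulr_suml.
    have -> : \sum_j (\sum_k e k j) * a j ^+ 2 = \sum_k \sum_j e k j * a j ^+ 2.
      by rewrite exchange_big; apply: eq_bigr => j _; rewrite mulr_suml.
    rewrite -big_split mulr_suml; apply: eq_bigr => k _ /=.
    rewrite -big_split mulr_suml; apply: eq_bigr => j _ /=.
    by rewrite mulrA mulrDr.
  have h (f : 'I_S -> R) : (forall k, f k <= eps) ->
      \sum_k f k * a k ^+ 2 <= eps * l2norm v ^+ 2.
    move=> fe; rewrite l2norm_sq big_distrr /=; apply: ler_sum => k _.
    by rewrite ler_wpM2r ?sqr_ge0.
  rewrite ler_pdivrMr // mulr_natr mulr2n lerD //; exact: h.
rewrite E lerBlDr -[leLHS](ger0_norm (sqr_ge0 _)) -cmodR.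
rewrite -[X in cmod X <= _](addrK d); apply: le_trans (cmodB _ _) _.
by rewrite lerD2l.
Qed.

Lemma vandermonde_lower_bound (v : 'cV[R[i]]_S) :
  (1 - eps) * l2norm v <= K * l2norm ((\matrix_(m < n, j < S) z j ^+ m) *m v).
Proof.
set w := _ *m v.
have [->|v0] := eqVneq v 0.
  by rewrite l2norm0 mulr0 mulr_ge0 ?l2norm_ge0.
have vn : 0 < l2norm v by rewrite l2norm_gt0.
rewrite -(ler_pM2l vn) mulrCA -expr2 mulrBl mul1r.
apply: le_trans (P_value v) _; rewrite P_pairing -/w.
apply: le_trans (cmod_sum _ _ _) _; under eq_bigr => m _ do rewrite cmodM.
apply: le_trans (cauchy_schwarz_sqrt _ _) _; rewrite mulrA.
apply: ler_wpM2r; first exact: l2norm_ge0.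
apply: le_trans (P_norm v); rewrite le_eqVlt; apply/orP; left; apply/eqP;
  congr Num.sqrt.
by apply: eq_bigr => i _; rewrite mxE.
Qed.

End Duality.

(** * Separated points *)

Section UnitCircle.
Variable R : realType.
Local Notation C := R[i].
Implicit Types a b w : R.

Lemma cexpiD a b : cexpi (a + b) = cexpi a * cexpi b.
Proof.
apply/eqP; rewrite eq_complex /= cosD sinD eqxx /=.
by rewrite addrC mulrC [sin b * _]mulrC; apply/eqP; ring.
Qed.

Lemma cexpi0 : cexpi 0 = 1 :> C.
Proof. by rewrite /cexpi cos0 sin0. Qed.

Lemma cmod_cexpi a : cmod (cexpi a) = 1.
Proof. by rewrite /cmod /= cos2Dsin2 sqrtr1. Qed.

Definition node w : C := cexpi (- (2 * pi * w)).

Lemma cmod_node w : cmod (node w) = 1.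
Proof. exact: cmod_cexpi. Qed.

Lemma node_neq0 w : node w != 0.
Proof. by rewrite -cmod_eq0 cmod_node oner_eq0. Qed.

Lemma nodeD a b : node (a + b) = node a * node b.
Proof. by rewrite /node -cexpiD; congr cexpi; ring. Qed.

Lemma node0 : node 0 = 1.
Proof. by rewrite /node mulr0 oppr0 cexpi0. Qed.

Lemma nodeN w : node (- w) = (node w)^-1.
Proof.
by apply: (mulfI (node_neq0 w)); rewrite -nodeD subrr node0 divff ?node_neq0.
Qed.

Lemma nodeX w t : node w ^+ t = node (t%:R * w).
Proof.
elim: t => [|t IH]; first by rewrite mul0r node0.
by rewrite exprS IH -nodeD; congr node; rewrite -natr1; ring.
Qed.

Lemma node1 : node 1 = 1.
Proof.
have -> : node 1 = cexpi (- (pi *+ 2)) by rewrite /node mulr1 mulr_natl.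
by rewrite /cexpi cosN sinN cos2pi sin2pi oppr0.
Qed.

Lemma node_int (n : int) : node n%:~R = 1.
Proof.
have nat1 (m : nat) : node m%:R = 1.
  by rewrite -[m%:R]mulr1 -nodeX node1 expr1n.
case: n => n; first exact: nat1.
by rewrite NegzE mulrNz nodeN -[n.+1%:~R]/(n.+1%:R) nat1 invr1.
Qed.

Lemma nodeD_int w (n : int) : node (w + n%:~R) = node w.
Proof. by rewrite nodeD node_int mulr1. Qed.

Lemma cmod_node_sub1 w : cmod (node w - 1) = 2 * `|sin (pi * w)|.
Proof.
have -> : node w = cexpi (- ((pi * w) *+ 2)) by rewrite /node; congr cexpi;
  ring.
rewrite -[RHS]ger0_norm ?mulr_ge0 // -sqrtr_sqr; congr Num.sqrt => /=.
rewrite cosN sinN cos_mulr2n sin_mulr2n exprMn real_normK ?num_real //.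
have := cos2Dsin2 (pi * w).
move: (cos _) (sin _) => c s cs;
  have -> : c ^+ 2 = 1 - s ^+ 2 by rewrite -cs addrK.
have -> : (- ((c * s) *+ 2) - 0) ^+ 2 = 4 * c ^+ 2 * s ^+ 2 by ring.
have -> : c ^+ 2 = 1 - s ^+ 2 by rewrite -cs addrK.
by ring.
Qed.

Lemma cmod_node_sub a b : cmod (node a - node b) = 2 * `|sin (pi * (a - b))|.
Proof.
rewrite -cmod_node_sub1 -[LHS]mulr1 -(cmod_node (- b)) -cmodM mulrBl -!nodeD.
by rewrite subrr node0.
Qed.

Lemma sin_pi_ge (x : R) : `|x| <= 1 / 2 -> 2 * `|x| <= `|sin (pi * x)|.
Proof.
move=> x2; have pi0 := pi_gt0 R.
have -> : `|sin (pi * x)| = `|sin (pi * `|x|)|.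
  by case: (ger0P x) => // _; rewrite mulrN sinN normrN.
apply: le_trans (ler_norm _).
have -> : 2 * `|x| = 2 * (pi * `|x|) / pi.
  by rewrite mulrCA [pi * _]mulrC mulfK // gt_eqF.
apply: sin_ge_chord; rewrite mulr_ge0 ?pi_ge0 //= ler_pM2l //.
by move: x2; rewrite div1r.
Qed.

Lemma distT_ge0 w : 0 <= distT w.
Proof. by have [n ->] := distT_attained w; exact: normr_ge0. Qed.

Lemma distT_le_half w : distT w <= 1 / 2.
Proof.
have /andP[fl fu] := floor_itv w.
have h1 := distT_le w (Num.floor w); rewrite ger0_norm ?subr_ge0 // in h1.
have h2 := distT_le w (Num.floor w + 1).
rewrite ler0_norm ?subr_le0 ?(ltW fu) // rmorphD /= in h2.
lra.
Qed.

Lemma distTN w : distT (- w) = distT w.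
Proof.
have le a : distT (- a) <= distT a.
  have [n ->] := distT_attained a; apply: le_trans (distT_le _ (- n)) _.
  by rewrite rmorphN /= opprK addrC distrC.
by apply/eqP; rewrite eq_le le /= -{1}[w]opprK le.
Qed.

(** After subtracting the nearest integer the difference is at most 1/2 in modulus, where the chord
    bound for sine applies. *)
Lemma cmod_node_sub_ge a b : 4 * distT (a - b) <= cmod (node a - node b).
Proof.
have [n dE] := distT_attained (a - b).
have -> : node a = node (a - n%:~R)
  by rewrite -[a in LHS](subrK n%:~R) nodeD_int.
have d2 := distT_le_half (a - b); rewrite dE in d2 *.
rewrite cmod_node_sub; have := sin_pi_ge d2.
have -> : a - n%:~R - b = a - b - n%:~R by ring.
lra.
Qed.

(** Geometric sum: multiplied by w - 1 it becomes w^(q+1) - 1, of modulus at most 2, while |w - 1|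
    is at least 4 times the distance. *)
Lemma dirichlet_far q a b : 0 < distT (a - b) ->
  cmod ((dirichlet q (node b)^-1).[node a]) <= (2 * q.+1%:R * distT (a - b))^-1.
Proof.
move=> d0; rewrite horner_dirichlet cmodM cmodV cmod_nat.
set w := _ * node a.
have wE : cmod (w - 1) = cmod (node a - node b).
  have -> : w - 1 = (node b)^-1 * (node a - node b).
    by rewrite mulrBr mulVf ?node_neq0.
  by rewrite cmodM cmodV cmod_node invr1 mul1r.
have w1 : cmod w = 1 by rewrite cmodM cmodV !cmod_node invr1 mul1r.
have far : 4 * distT (a - b) <= cmod (w - 1) by rewrite wE cmod_node_sub_ge.
have wn0 : 0 < cmod (w - 1) by apply: lt_le_trans far; lra.
have h : cmod (w - 1) * cmod (\sum_(i < q.+1) w ^+ i) <= 2.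
  rewrite -cmodM -subrX1; apply: le_trans (cmodB _ _) _.
  by rewrite cmodX w1 expr1n cmod1; lra.
have -> : (2 * q.+1%:R * distT (a - b))^-1 = (2 * distT (a - b))^-1 / q.+1%:R.
  by rewrite -invfM mulrAC.
rewrite ler_wpM2r ?invr_ge0 // -[leRHS]mul1r ler_pdivlMr ?mulr_gt0 //.
set s := cmod (\sum_(_ < _) _) in h *.
have s0 : 0 <= s := cmod_ge0 _.
have : 4 * distT (a - b) * s <= 2 by apply: le_trans h; rewrite ler_wpM2r.
lra.
Qed.

End UnitCircle.

(** * Ranks of separated real points *)

Section Rank.
Variables (R : realType) (T : finType) (Lam : {set T}) (u : T -> R) (g : R).
Hypothesis g_gt0 : 0 < g.
Hypothesis gap : {in Lam &, forall j k, j != k -> g <= `|u j - u k|}.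

Let between j k := [set l in Lam | u j <= u l < u k]%SET.

(** Induction on the number of points: if [l] is the largest point of [between j k], the others form
    [between j l], and the last gap from [l] to [k] is at least [g]. *)
Lemma gap_between j k : j \in Lam -> k \in Lam -> u j <= u k ->
  #|between j k|%:R * g <= u k - u j.
Proof.
move=> jL; move: {2}#|_| (leqnn #|between j k|) => m.
elim: m k => [|m IH] k cm kL jk.
  by move: cm; rewrite leqn0 => /eqP ->; rewrite mul0r subr_ge0.
move: jk; rewrite le_eqVlt => /predU1P[jkE|jk].
  have -> : between j k = finset.set0.
    apply/finset.setP => l; rewrite !inE jkE; case: (l \in Lam) => //=.
    by apply/negP => /andP[h1 h2]; have := le_lt_trans h1 h2; rewrite ltxx.
  by rewrite cards0 mul0r jkE subrr.
have jb : j \in between j k by rewrite !inE jL lexx.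
have [l lb lmax] := @arg_maxP _ R T j (mem (between j k)) u jb.
have /andP[lL /andP[jl lk]] : (l \in Lam) && (u j <= u l < u k).
  by have : l \in between j k := lb; rewrite !inE.
have sub : between j l \subset between j k :\ l.
  apply/fintype.subsetP => i; rewrite !inE => /andP[-> /andP[-> il]] /=.
  rewrite (lt_trans il lk) andbT.
  by apply: contraTneq il => ->; rewrite ltxx.
have bE : between j k :\ l = between j l.
  apply/eqP; rewrite finset.eqEsubset sub andbT; apply/fintype.subsetP => i.
  rewrite !inE => /and3P[il iL /andP[ji ik]].
  have ib : i \in between j k by rewrite !inE iL ji.
  have ul : u i <= u l := lmax i ib.
  rewrite iL ji /= lt_neqAle ul andbT.
  apply/negP => /eqP uil; have := gap iL lL il.
  by rewrite uil subrr normr0 leNgt g_gt0.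
have cE : #|between j k| = #|between j l|.+1.
  by rewrite -bE (cardsD1 l (between j k)) (_ : l \in between j k).
have := IH l _ lL jl; rewrite -ltnS -cE cm => /(_ isT) h.
have gl : g <= u k - u l.
  have kl : k != l by apply: contraTneq lk => ->; rewrite ltxx.
  by have := gap kL lL kl; rewrite gtr0_norm // subr_gt0.
by rewrite cE -natr1; lra.
Qed.

Let rank j := #|[set l in Lam | u l < u j]%SET|.

Let rank_between j k : u j <= u k -> rank k = (rank j + #|between j k|)%N.
Proof.
move=> jk; rewrite /rank -(cardsID [set l | u l < u j]%SET [set l in Lam | u l
  < u k]%SET).
congr (_ + _)%N; apply: eq_card => l; rewrite !inE.
  by case: (l \in Lam) => //=; apply/andP/idP => [[]//|lj]; split=> //;
    exact: lt_le_trans jk.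
by rewrite -leNgt; case: (l \in Lam) => //=; rewrite ?andbF.
Qed.

Let rank_gap j k : j \in Lam -> k \in Lam ->
  g * `|(rank j)%:R - (rank k)%:R| <= `|u j - u k|.
Proof.
wlog jk : j k / u j <= u k => [H|] jL kL.
  have [jk|/ltW kj] := leP (u j) (u k); first exact: H.
  by rewrite distrC [leRHS]distrC; exact: H.
rewrite distrC [leRHS]distrC (rank_between jk) natrD addrAC subrr add0r.
by rewrite normr_nat ger0_norm ?subr_ge0 // mulrC gap_between.
Qed.

(** Sorting replaces separated points by integers, so that sums and products over them can be
    compared with explicit ones. Two points of equal rank have none between them, hence coincide. *)
Lemma exists_rank l : #|Lam| = l.+1 -> exists r : T -> 'I_l.+1,
  {in Lam &, injective r} /\
  {in Lam &, forall j k, g * `|(r j)%:R - (r k)%:R| <= `|u j - u k|}.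
Proof.
move=> cL; exists (fun j => inord (rank j)).
have rank_lt j : j \in Lam -> (rank j < l.+1)%N.
  move=> jL; rewrite -cL; apply: proper_card; apply/properP; split.
    by apply/fintype.subsetP => i; rewrite !inE => /andP[].
  by exists j => //; rewrite !inE ltxx andbF.
have inord_rank j : j \in Lam -> (inord (rank j) : 'I_l.+1) = rank j :> nat.
  by move=> jL; rewrite inordK // rank_lt.
split=> j k jL kL; last by rewrite !inord_rank //; exact: rank_gap.
move=> /(congr1 val) /=; rewrite !inord_rank // => rE.
wlog jk : j k jL kL rE / u j <= u k => [H|].
  have [jk|/ltW kj] := leP (u j) (u k); first exact: H.
  by apply/esym; exact: H.
have b0 : #|between j k| = 0%N.
  by move: (rank_between jk); rewrite rE => /eqP;
    rewrite -{1}[rank k]addn0 eqn_add2l => /eqP.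
apply/eqP; apply/negPn/negP => njk; have := gap jL kL njk.
move: jk; rewrite le_eqVlt => /predU1P[->|jk].
  by rewrite subrr normr0 leNgt g_gt0.
have : j \in between j k by rewrite !inE jL lexx.
by move/eqP: b0; rewrite cards_eq0 => /eqP ->; rewrite !inE.
Qed.

End Rank.

Section InverseSquares.
Variable R : realType.

Lemma sum_inv_sqr_le2 N : \sum_(0 <= i < N) (i.+1%:R ^+ 2)^-1 <= 2 :> R.
Proof.
case: N => [|N]; first by rewrite big_geq.
(* The correction 1/(N+1) makes the induction go through, since 1/(x+1)^2 <= 1/x - 1/(x+1). *)
suff : \sum_(0 <= i < N.+1) (i.+1%:R ^+ 2)^-1 <= 2 - N.+1%:R^-1 :> R.
  by move=> h; apply: le_trans h _; rewrite lerBlDr lerDl invr_ge0 ler0n.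
elim: N => [|N IH]; first by rewrite big_nat1 expr1n invr1; lra.
rewrite big_nat_recr //=; apply: (le_trans (lerD IH (lexx _))).
rewrite -[N.+2%:R]natr1; have : (0 : R) < N.+1%:R by rewrite ltr0n.
move: (N.+1%:R) => x x0; rewrite -subr_ge0.
have -> : 2 - (x + 1)^-1 - (2 - x^-1 + ((x + 1) ^+ 2)^-1) =
    (x * (x + 1) ^+ 2)^-1 by field; rewrite !gt_eqF ?addr_gt0.
by rewrite invr_ge0 mulr_ge0 ?sqr_ge0 // ltW.
Qed.

(** Each side of [i0] contributes at most 2. *)
Lemma sum_inv_sqr_dist_le4 n (i0 : 'I_n) :
  \sum_(i < n | i != i0) ((i%:R - i0%:R) ^+ 2)^-1 <= 4 :> R.
Proof.
pose F (i : nat) : R := ((i%:R - i0%:R) ^+ 2)^-1.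
rewrite -(big_mkord (fun i => i != i0) F).
rewrite (big_cat_nat (leq0n i0) (ltnW (ltn_ord i0))) /=.
have -> : (4 : R) = 2 + 2 by ring.
apply: lerD.
  apply: le_trans (sum_inv_sqr_le2 i0).
  rewrite [leRHS]big_nat_rev /= add0n big_mkcond big_nat [leRHS]big_nat.
  apply: ler_sum => i /andP[_ ii]; rewrite (ltn_eqF ii) /= /F.
  by rewrite -opprB sqrrN -natrB 1?ltnW // subnSK.
rewrite big_ltn_cond // eqxx /=.
apply: le_trans (sum_inv_sqr_le2 (n - i0.+1)).
rewrite -{1}[i0.+1]add0n big_addn big_mkcond; apply: ler_sum => i _.
rewrite /F addnS -addSn; case: ifP => _; last by rewrite invr_ge0 sqr_ge0.
by rewrite natrD addrK.
Qed.

End InverseSquares.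

(** * The interpolant of a clump *)

(** By cardinality [r] maps [Lam] onto all ranks. Ranks start at 0 and the indices of [clump_C] at
    1, hence the predecessors. *)
Lemma sum_prod_rank (R : comNzRingType) (T : finType) (Lam : {set T}) l
    (r : T -> 'I_l.+1) (F : nat -> nat -> R) :
  #|Lam| = l.+1 -> {in Lam &, injective r} ->
  \sum_(j in Lam) \prod_(k in Lam | k != j) F (r j) (r k) =
  \sum_(1 <= i < l.+2) \prod_(1 <= m < l.+2 | m != i) F i.-1 m.-1.
Proof.
move=> cL rinj; have rL : r @: Lam = [set: 'I_l.+1]%SET.
  by apply/eqP; rewrite eqEcard finset.subsetT cardsT card_ord card_in_imset //
    cL leqnn.
rewrite big_add1 big_mkord -[RHS]/(\sum_(i < l.+1) _).
transitivity (\sum_(i in r @: Lam) \prod_(1 <= m < l.+2 | m != i.+1) F i m.-1).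
  rewrite big_imset //=; apply: eq_bigr => j jL.
  rewrite big_add1 big_mkord /=.
  transitivity (\prod_(m in r @: Lam | m != r j) F (r j) m).
    rewrite big_imset_cond //=; apply: eq_bigl => k.
    by case kL: (k \in Lam) => //=; rewrite (inj_in_eq rinj).
  by rewrite rL; apply: eq_bigl => m; rewrite !inE eqSS.
by rewrite rL; apply: eq_bigl => i; rewrite inE.
Qed.

Section Clump.
Variables (R : realType) (L S : nat) (alpha : R) (omega : 'I_S -> R).
Variable Lam : {set 'I_S}.
Local Notation lam := #|Lam|.
Local Notation C := R[i].
Hypotheses (alpha_gt0 : 0 < alpha) (lamL : (lam <= L)%N).
Hypothesis arc : exists t : R, forall j, j \in Lam ->
  exists n : int, t < omega j + n%:~R < t + L%:R^-1.
Hypothesis sep : forall j k : 'I_S, j != k ->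
  alpha / L%:R <= distT (omega j - omega k).

(** These degrees satisfy (lambda - 1) t + 2 lambda q <= L. Moreover t/L <= 1/lambda, so the t-th
    powers of the nodes of a clump do not wrap around the circle. *)
Let t := (L %/ lam)%N.
Let q := (L %/ (2 * lam ^ 2))%N.
Let b j k : C := node (omega j) ^+ t - node (omega k) ^+ t.

(* The Lagrange basis of the clump in the variable ['X^t], damped away from
   [omega j] by a power of the Dirichlet kernel. *)
Definition clump_poly j : {poly C} :=
  (\prod_(k in Lam | k != j) ((b j k)^-1 *: ('X^t - (node (omega k) ^+ t)%:P)))
  * dirichlet q (node (omega j))^-1 ^+ (2 * lam).

Section Member.
Variable j : 'I_S.
Hypothesis jL : j \in Lam.

Let lam_gt0 : (0 < lam)%N. Proof. by apply/card_gt0P; exists j. Qed.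
Let L_gt0 : (0 < L)%N. Proof. exact: leq_trans lamL. Qed.
Let t_gt0 : (0 < t)%N. Proof. by rewrite divn_gt0. Qed.
Let LR_gt0 : 0 < L%:R :> R. Proof. by rewrite ltr0n. Qed.
Let lamR_gt0 : 0 < lam%:R :> R. Proof. by rewrite ltr0n. Qed.
Let tR_gt0 : 0 < t%:R :> R. Proof. by rewrite ltr0n. Qed.

Let t_lam_le : t%:R * lam%:R <= L%:R :> R.
Proof. by rewrite -natrM ler_nat leq_trunc_div. Qed.

Let L_le_t_lam : L%:R <= 2 * t%:R * lam%:R :> R.
Proof.
rewrite -!natrM ler_nat; have := ltn_ceil L lam_gt0; rewrite -/t => h.
apply: leq_trans (ltnW h) _; rewrite leq_mul2r; apply/orP; right.
by rewrite mul2n -addnn -addn1 leq_add2l.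
Qed.

Lemma lam_sqr_lt : L%:R <= 2 * lam%:R ^+ 2 * q.+1%:R :> R.
Proof.
rewrite -natrX -!natrM ler_nat mulnC; apply: ltnW; apply: ltn_ceil.
by rewrite muln_gt0 expn_gt0 lam_gt0.
Qed.

Lemma card_member_rest : #|[pred k | (k \in Lam) && (k != j)]| = lam.-1.
Proof.
rewrite (cardsD1 j Lam) jL /=; apply: eq_card => k.
by rewrite !inE andbC.
Qed.

Lemma size_clump_poly : (size (clump_poly j) <= L.+1)%N.
Proof.
have h1 : (size (\prod_(k in Lam | k != j)
    ((b j k)^-1 *: ('X^t - (node (omega k) ^+ t)%:P)))%R <= (lam.-1 * t).+1)%N.
  apply: leq_trans (size_prod_leq _ _) _.
  rewrite leq_subLR card_member_rest addnS ltnS -mulnS.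
  rewrite -card_member_rest -sum_nat_const; apply: leq_sum => k _.
  by apply: leq_trans (size_scale_leq _ _) _; rewrite size_XnsubC.
have h2 : (size (dirichlet q (node (omega j))^-1 ^+ (2 * lam))%R <= (q * (2 *
  lam)).+1)%N.
  apply: leq_trans (size_poly_exp_leq _ _) _; rewrite ltnS leq_mul2r.
  by apply/orP; right; rewrite -subn1 leq_subLR add1n size_dirichlet.
apply: leq_trans (size_polyMleq _ _) _.
apply: (@leq_trans (lam.-1 * t + q * (2 * lam)).+1).
  by rewrite -subn1 leq_subLR add1n -addnS -addSn leq_add.
(* Multiplying by lambda clears both quotients: the factors contribute at most (lambda - 1) L and
   L. *)
rewrite ltnS -(leq_pmul2l lam_gt0).
have e1 : (t * lam <= L)%N := leq_trunc_div _ _.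
have e2 : (q * (2 * lam ^ 2) <= L)%N := leq_trunc_div _ _.
have -> : (lam * (lam.-1 * t + q * (2 * lam)) = lam.-1 * (t * lam) + q * (2 *
  lam ^ 2))%N.
  rewrite mulnDr -mulnn; congr (_ + _)%N; first by rewrite mulnCA (mulnC lam t).
  by rewrite mulnCA (mulnCA lam 2).
apply: (@leq_trans (lam.-1 * L + L)).
  by apply: leq_add => //; rewrite leq_mul2l e1 orbT.
by rewrite -mulSnr prednK.
Qed.

(** Representatives modulo 1 that put the clump in one real interval of length 1/L; the separation
    survives because [distT] is below the modulus of any representative. *)
Let lifts : exists u : 'I_S -> R,
  [/\ forall i, node (u i) = node (omega i),
      {in Lam &, forall i k, `|u i - u k| < L%:R^-1} &
      forall i k, i != k -> alpha / L%:R <= `|u i - u k|].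
Proof.
have [s hs] := arc.
pose n i : int := if pselect (exists n : int, s < omega i + n%:~R < s + L%:R^-1)
  is left h then sval (cid h) else 0.
exists (fun i => omega i + (n i)%:~R); split=> [i|i k iL kL|i k ik].
- exact: nodeD_int.
- have hn l : l \in Lam -> s < omega l + (n l)%:~R < s + L%:R^-1.
    by move=> /hs h; rewrite /n; case: pselect => // h'; case: cid.
  have /andP[i1 i2] := hn i iL; have /andP[k1 k2] := hn k kL.
  by rewrite ltr_norml; apply/andP; split; lra.
- apply: le_trans (sep ik) _.
  have := distT_le (omega i - omega k) (n k - n i).
  rewrite rmorphB /=; congr (_ <= `|_|); ring.
Qed.

Let b_sin (u : 'I_S -> R) i k : (forall i, node (u i) = node (omega i)) ->
  cmod (b i k) = 2 * `|sin (pi * (t%:R * `|u i - u k|))|.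
Proof.
move=> uE; rewrite /b -!uE !nodeX cmod_node_sub -mulrBr.
by case: (ger0P (u i - u k)) => // _; rewrite !mulrN sinN normrN.
Qed.

Let t_diff_le (u : 'I_S -> R) i k : {in Lam &, forall i k,
  `|u i - u k| < L%:R^-1} ->
  i \in Lam -> k \in Lam -> t%:R * `|u i - u k| <= lam%:R^-1.
Proof.
move=> ud iL kL; apply: (@le_trans _ _ (t%:R / L%:R)).
  by rewrite ler_pM2l // ltW // ud.
by rewrite ler_pdivrMr // mulrC ler_pdivlMr.
Qed.

Let lam_ge2 i k : i \in Lam -> k \in Lam -> i != k -> 2 <= lam%:R :> R.
Proof.
by move=> iL kL ik; rewrite ler_nat; apply/card_gt1P; exists i, k.
Qed.

(** With x = t |u_j - u_k| <= 1/lambda <= 1/2, the chord bound gives 2 |sin(pi x)| >= 4 x >= 4 t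
    alpha / L, and L <= 2 t lambda. *)
Lemma node_pow_diff_ge k : k \in Lam -> k != j -> 2 * alpha / lam%:R <= cmod (b
  j k).
Proof.
move=> kL kj; have [u [uE ud us]] := lifts; rewrite (b_sin _ _ uE).
have l2 : 2 <= lam%:R :> R by apply: (lam_ge2 jL kL); rewrite eq_sym.
have x0 : 0 <= t%:R * `|u j - u k| by rewrite mulr_ge0.
have x2 : `|t%:R * `|u j - u k| | <= 1 / 2.
  rewrite ger0_norm // (le_trans (t_diff_le ud jL kL)) //.
  by rewrite div1r lef_pV2 ?posrE.
have := sin_pi_ge x2; rewrite (ger0_norm x0) => h.
have us' : alpha / L%:R <= `|u j - u k| by rewrite us // eq_sym.
have h2 : t%:R * (alpha / L%:R) <= t%:R * `|u j - u k| by rewrite ler_pM2l.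
have h3 : alpha / lam%:R <= 2 * (t%:R * (alpha / L%:R)).
  rewrite ler_pdivrMr //.
  have -> : 2 * (t%:R * (alpha / L%:R)) * lam%:R = alpha * (2 * t%:R * lam%:R)
    / L%:R.
    by field; rewrite gt_eqF.
  by rewrite ler_pdivlMr // ler_pM2l.
have -> : 2 * alpha / lam%:R = 2 * (alpha / lam%:R) by rewrite mulrA.
lra.
Qed.

Lemma node_pow_diff_gt0 k : k \in Lam -> k != j -> 0 < cmod (b j k).
Proof.
move=> kL kj; apply: lt_le_trans (node_pow_diff_ge kL kj).
by rewrite divr_gt0 ?mulr_gt0.
Qed.

Lemma inv_node_pow_diff_le k : k \in Lam -> k != j ->
  2 / cmod (b j k) <= lam%:R / alpha.
Proof.
move=> kL kj; have h := node_pow_diff_ge kL kj.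
rewrite ler_pdivrMr ?node_pow_diff_gt0 //.
have -> : lam%:R / alpha * cmod (b j k) = cmod (b j k) * lam%:R / alpha by ring.
by rewrite ler_pdivlMr // -ler_pdivrMr.
Qed.

Lemma clump_poly_self : (clump_poly j).[node (omega j)] = 1.
Proof.
rewrite hornerM horner_exp horner_dirichlet1 ?mulVf ?node_neq0 // expr1n mulr1.
rewrite horner_prod big1 // => k /andP[kL kj].
rewrite hornerZ hornerD hornerN hornerXn hornerC mulVf //.
by rewrite -cmod_eq0 gt_eqF // node_pow_diff_gt0.
Qed.

Lemma clump_poly_other k : k \in Lam -> k != j ->
  (clump_poly j).[node (omega k)] = 0.
Proof.
move=> kL kj; rewrite hornerM horner_prod (bigD1 k) ?kL //=.
have mul00 (x y z : C) : x = 0 -> x * y * z = 0 by move=> ->; rewrite !mul0r.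
by apply: mul00; rewrite hornerZ hornerD hornerN hornerXn hornerC subrr mulr0.
Qed.

Local Notation G := (\prod_(k in Lam | k != j) (2 / cmod (b j k))).

Let G_ge0 : 0 <= G.
Proof. by apply: prodr_ge0 => k _; rewrite divr_ge0 ?cmod_ge0. Qed.

Lemma coef_norm_clump_poly n : coef_norm n (clump_poly j) <= G * (Num.sqrt
  q.+1%:R)^-1.
Proof.
apply: le_trans (coef_norm_prod_XnsubC _ _ _ _ _ _) _.
  by move=> k _; rewrite cmodX cmod_node expr1n.
have u1 : cmod (node (omega j))^-1 = 1 by rewrite cmodV cmod_node invr1.
have lam2 : (0 < 2 * lam)%N by rewrite muln_gt0.
by rewrite ler_wpM2l // -(prednK lam2); exact: coef_norm_dirichletX.
Qed.

(** Each numerator has modulus at most 2. This crude bound serves outside the clump, where the power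
    of the kernel compensates for it; the coefficient norm uses the sharper [exists_clump_rank]. *)
Lemma clump_poly_value_le w : cmod ((clump_poly j).[node w]) <=
  (lam%:R / alpha) ^+ lam.-1 *
  cmod ((dirichlet q (node (omega j))^-1).[node w]) ^+ (2 * lam).
Proof.
rewrite hornerM cmodM horner_exp cmodX ler_wpM2r ?exprn_ge0 ?cmod_ge0 //.
rewrite horner_prod cmod_prod -card_member_rest -prodr_const.
apply: ler_prod => k /andP[kL kj]; rewrite cmod_ge0 /=.
apply: le_trans (inv_node_pow_diff_le kL kj).
rewrite hornerZ cmodM cmodV mulrC ler_wpM2r ?invr_ge0 ?cmod_ge0 //.
rewrite hornerD hornerN hornerXn hornerC.
by apply: le_trans (cmodB _ _) _; rewrite !cmodX !cmod_node !expr1n.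
Qed.

Local Notation kap := (1 - pi ^+ 2 / (3 * lam%:R ^+ 2) : R).
Local Notation X := (L%:R / (pi * t%:R * alpha) : R).

Lemma clump_kappa_gt0 : 2 <= lam%:R :> R -> 0 < kap.
Proof.
move=> l2; rewrite subr_gt0 ltr_pdivrMr ?mul1r ?mulr_gt0 ?exprn_gt0 //.
apply: lt_le_trans (sqr_pi_lt12 R) _.
have : 2 ^+ 2 <= lam%:R ^+ 2 :> R by rewrite lerXn2r ?nnegrE.
lra.
Qed.

(** Here 2/|b| is 1/|sin x| with x = pi t |u_i - u_k| <= pi/lambda, whence sin^2 x >= kap x^2, while
    x is at least pi t alpha / L times the difference of ranks. *)
Lemma exists_clump_rank : exists r : 'I_S -> 'I_lam.-1.+1,
  {in Lam &, injective r} /\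
  {in Lam &, forall i k, k != i ->
    (2 / cmod (b i k)) ^+ 2 <= kap^-1 * X ^+ 2 * (((r i)%:R - (r k)%:R) ^+
      2)^-1}.
Proof.
have [u [uE ud us]] := lifts.
have g0 : 0 < alpha / L%:R by rewrite divr_gt0.
have gap : {in Lam &, forall i k, i != k -> alpha / L%:R <= `|u i - u k|}.
  by move=> i k _ _; exact: us.
have [r [rinj rgap]] := exists_rank g0 gap (esym (prednK lam_gt0)).
exists r; split=> // i k iL kL; rewrite eq_sym => ik.
have l2 := lam_ge2 iL kL ik; have kap0 := clump_kappa_gt0 l2.
have pi0 := pi_gt0 R.
set d := (r i)%:R - (r k)%:R.
have d0 : d != 0.
  rewrite subr_eq0 eqr_nat; apply: contra ik => /eqP/val_inj/rinj rik.
  by apply/eqP; exact: rik.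
pose x := pi * (t%:R * `|u i - u k|).
have x0 : 0 <= x by rewrite !mulr_ge0 // ltW.
have xl : x <= pi / lam%:R by rewrite ler_pM2l // t_diff_le.
have x2 : x <= pi / 2 by apply: le_trans xl _;
  rewrite ler_pM2l // lef_pV2 ?posrE.
have xkap : kap <= 1 - x ^+ 2 / 3.
  have : x ^+ 2 <= (pi / lam%:R) ^+ 2
    by rewrite lerXn2r ?nnegrE // divr_ge0 // ltW.
  rewrite expr_div_n => h; rewrite lerD2l lerN2.
  have -> : pi ^+ 2 / (3 * lam%:R ^+ 2) = (pi ^+ 2 / lam%:R ^+ 2) / 3 :> R.
    by field; rewrite gt_eqF.
  by rewrite ler_pM2r.
have xd : (pi * t%:R * alpha / L%:R) ^+ 2 * d ^+ 2 <= x ^+ 2.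
  rewrite -[d ^+ 2]real_normK ?num_real // -exprMn lerXn2r ?nnegrE //.
    by rewrite !mulr_ge0 ?invr_ge0 // ltW.
  have -> : pi * t%:R * alpha / L%:R * `|d| = pi * (t%:R * (alpha / L%:R *
    `|d|)).
    by ring.
  by rewrite !ler_pM2l // rgap.
have key : kap * ((pi * t%:R * alpha / L%:R) ^+ 2 * d ^+ 2) <= sin x ^+ 2.
  apply: le_trans (sqr_sin_ge _); last by rewrite x0.
  rewrite [leRHS]mulrC; apply: ler_pM => //; first exact: ltW.
  by rewrite mulr_ge0 ?sqr_ge0.
have lhs0 : 0 < kap * ((pi * t%:R * alpha / L%:R) ^+ 2 * d ^+ 2).
  have y0 : 0 < pi * t%:R * alpha / L%:R by rewrite divr_gt0 ?mulr_gt0.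
  apply: mulr_gt0 kap0 _; apply: mulr_gt0; first exact: exprn_gt0.
  by rewrite exprn_even_gt0.
have sin0 : 0 < sin x ^+ 2 := lt_le_trans lhs0 key.
have -> : (2 / cmod (b i k)) ^+ 2 = (sin x ^+ 2)^-1.
  rewrite (b_sin _ _ uE) -/x invfM mulrA divff // mul1r exprVn.
  by rewrite real_normK ?num_real.
have -> : kap^-1 * X ^+ 2 * (d ^+ 2)^-1 =
    (kap * ((pi * t%:R * alpha / L%:R) ^+ 2 * d ^+ 2))^-1.
  have -> : X = (pi * t%:R * alpha / L%:R)^-1 by rewrite invf_div.
  by rewrite exprVn -!invfM mulrA.
by rewrite lef_pV2 ?posrE.
Qed.

Lemma powR_half_sqr : (kap `^ (- ((lam%:R - 1) / 2))) ^+ 2 = (kap ^+ lam.-1)^-1.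
Proof.
(* For lambda = 1 the base [kap] is negative, but both exponents are 0. *)
have [l1|l1] := eqVneq lam 1%N.
  by rewrite l1 subrr mul0r oppr0 powRr0 expr0 expr1n invr1.
have l2 : 2 <= lam%:R :> R by rewrite ler_nat ltn_neqAle eq_sym l1.
have k0 := clump_kappa_gt0 l2.
have -> : (kap ^+ lam.-1)^-1 = kap `^ (- lam.-1%:R).
  by rewrite powRN powR_mulrn // ltW.
rewrite -powR_mulrn ?powR_ge0 // -powRrM; congr (_ `^ _).
rewrite -subn1 natrB // mulNr; congr (- _).
by rewrite mulfVK.
Qed.

End Member.

(** The rank bound turns the products of 2/|b| into the sum of products in [clump_C], and 1/(q+1) <=
    2 lambda^2 / L supplies the rest. The factor (19/20)^2 anticipates the loss 1 - 1/20 in the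
    duality argument. *)
Lemma sum_coef_norm_clump n : (0 < lam)%N ->
  \sum_(i in Lam) coef_norm n (clump_poly i) ^+ 2 <=
  (19 / 20) ^+ 2 / L%:R * (clump_C R lam L * alpha ^- lam.-1) ^+ 2.
Proof.
move=> lam_gt0; have [j jL] := card_gt0P lam_gt0.
have [r [rinj]] := exists_clump_rank jL.
set kap := 1 - _; set X := _ / _; set Y := kap^-1 * X ^+ 2 => rle.
have cL : lam = lam.-1.+1 by rewrite prednK.
pose F (i m : nat) : R := ((i%:R - m%:R) ^+ 2)^-1.
have F_ge0 i m : 0 <= F i m by rewrite invr_ge0 sqr_ge0.
pose Sg := \sum_(1 <= i < lam.+1) \prod_(1 <= m < lam.+1 | m != i) F i m.
have Sg_ge0 : 0 <= Sg by apply: sumr_ge0 => i _; apply: prodr_ge0.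
have SgE : \sum_(i in Lam) \prod_(k in Lam | k != i) F (r i) (r k) = Sg.
  rewrite (sum_prod_rank _ cL rinj) -cL /Sg big_nat [RHS]big_nat.
  apply: eq_bigr => i /andP[i0 _]; rewrite big_nat_cond [RHS]big_nat_cond.
  apply: eq_bigr => m /andP[/andP[m0 _] _]; rewrite /F.
  rewrite -[in RHS](prednK i0) -[in RHS](prednK m0) -!natr1.
  by congr (_ ^-1); ring.
have step i : i \in Lam -> coef_norm n (clump_poly i) ^+ 2 <=
    Y ^+ lam.-1 * \prod_(k in Lam | k != i) F (r i) (r k) * q.+1%:R^-1.
  move=> iL; have h := coef_norm_clump_poly iL n.
  have h2 := le_trans (coef_norm_ge0 _ _) h.
  apply: (@le_trans _ _ ((\prod_(k in Lam | k != i) (2 / cmod (b i k)) *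
      (Num.sqrt q.+1%:R)^-1) ^+ 2)).
    by rewrite lerXn2r ?nnegrE ?coef_norm_ge0.
  rewrite exprMn exprVn sqr_sqrtr ?ler0n // ler_wpM2r ?invr_ge0 ?ler0n //.
  have -> : Y ^+ lam.-1 = \prod_(k in Lam | k != i) Y.
    by rewrite prodr_const card_member_rest.
  rewrite -big_split -prodrXl /=.
  by apply: ler_prod => k /andP[kL ki]; rewrite sqr_ge0 rle.
apply: le_trans (ler_sum _ step) _.
rewrite -mulr_suml -mulr_sumr SgE.
have L0 : 0 < L%:R :> R by rewrite ltr0n (leq_trans lam_gt0).
have l0 : 0 < lam%:R :> R by rewrite ltr0n.
have t0 : t%:R != 0 :> R by rewrite pnatr_eq0 -lt0n divn_gt0.
have Y0 : 0 <= Y ^+ lam.-1.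
  have := leq_trans lam_gt0 (leqnn _); rewrite leq_eqVlt => /predU1P[<-|l2].
    by rewrite expr0.
  rewrite exprn_ge0 // mulr_ge0 ?sqr_ge0 // invr_ge0 ltW //.
  by apply: (clump_kappa_gt0 jL); rewrite ler_nat.
have q1 : q.+1%:R^-1 <= 2 * lam%:R ^+ 2 / L%:R :> R.
  rewrite -[leLHS]div1r ler_pdivrMr ?ltr0n // mulrAC ler_pdivlMr // mul1r.
  exact: (lam_sqr_lt jL).
apply: le_trans (ler_wpM2l (mulr_ge0 Y0 Sg_ge0) q1) _.
have al0 : alpha ^+ lam.-1 != 0 by rewrite expf_neq0 // gt_eqF.
have pi0 : (pi : R) ^+ lam.-1 != 0 by rewrite expf_neq0 // gt_eqF // pi_gt0.
have tm0 : (t%:R : R) ^+ lam.-1 != 0 by rewrite expf_neq0.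
have lm0 : (lam%:R : R) ^+ lam.-1 != 0 by rewrite expf_neq0 // gt_eqF.
have YE : Y ^+ lam.-1 = (kap ^+ lam.-1)^-1 *
    (L%:R ^+ lam.-1 / (pi ^+ lam.-1 * t%:R ^+ lam.-1 * alpha ^+ lam.-1)) ^+ 2.
  by rewrite /Y exprMn exprVn exprAC expr_div_n !exprMn.
(* 800/361 is the square of 20 sqrt 2 / 19; times (19/20)^2 it leaves the 2 of the bound on
   1/(q+1). *)
have CE : (clump_C R lam L * alpha ^- lam.-1) ^+ 2 =
    800 / 361 * (kap ^+ lam.-1)^-1 * (L%:R ^+ lam.-1 / lam%:R ^+ lam.-1) ^+ 2 *
    (t%:R ^- lam.-1) ^+ 2 * lam%:R ^+ 2 * (lam%:R ^+ lam.-1 / pi ^+ lam.-1) ^+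
      2 *
    Sg * (alpha ^- lam.-1) ^+ 2.
  have sq2 : Num.sqrt 2 ^+ 2 = 2 :> R by rewrite sqr_sqrtr.
  have -> : (800 / 361 : R) = 400 / 361 * Num.sqrt 2 ^+ 2 by rewrite sq2; field.
  rewrite -(powR_half_sqr jL) -[X in _ * X * _](sqr_sqrtr Sg_ge0) -!expr_div_n.
  by rewrite /clump_C /clump_B -/Sg -/t -/kap; field; rewrite al0 tm0.
rewrite YE CE le_eqVlt; apply/orP; left; apply/eqP.
move: (kap ^+ lam.-1)^-1 (alpha ^+ lam.-1) (pi ^+ lam.-1) (t%:R ^+ lam.-1)
  (lam%:R ^+ lam.-1) (L%:R ^+ lam.-1) al0 pi0 tm0 lm0.
move=> K a p tm lm Lm a0 p0 tm0 lm0.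
by field; rewrite ?a0 ?p0 ?tm0 ?lm0 ?gt_eqF.
Qed.

End Clump.

(** * Lower bound for the Fourier matrix *)

(** Lifting each omega_k - omega_j to its representative nearest 0 turns distances to omega_j into
    moduli and keeps the separation alpha/L. By ranks, the k-th distance is then at least alpha/L
    times an integer, and inverse squares sum to at most 4. *)
Lemma sum_inv_sqr_distT_le (R : realType) (S L : nat) (alpha : R) (omega : 'I_S
  -> R)
    (j : 'I_S) : 0 < alpha -> (0 < L)%N ->
  (forall i k, i != k -> alpha / L%:R <= distT (omega i - omega k)) ->
  \sum_(k | k != j) ((L%:R * distT (omega k - omega j))^-1) ^+ 2 <= 4 / alpha
    ^+ 2.
Proof.
move=> a0 L0 sep; have LR : 0 < L%:R :> R by rewrite ltr0n.
have g0 : 0 < alpha / L%:R by rewrite divr_gt0.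
pose n k := sval (cid (distT_attained (omega k - omega j))).
have nE k : distT (omega k - omega j) = `|omega k - omega j - (n k)%:~R|.
  by rewrite /n; case: cid.
pose u k := omega k - omega j - (n k)%:~R.
have uj : u j = 0.
  apply/eqP; rewrite -normr_eq0 -nE subrr; apply/eqP/le_anti.
  by rewrite distT_ge0 andbT; apply: le_trans (distT_le 0 0) _;
    rewrite subrr normr0.
have gap : {in [set: 'I_S]%SET &, forall i k,
  i != k -> alpha / L%:R <= `|u i - u k|}.
  move=> i k _ _ ik; apply: le_trans (sep _ _ ik) _.
  have := distT_le (omega i - omega k) (n i - n k).
  by rewrite rmorphB /u /=; congr (_ <= `|_|); ring.
have cS : #|[set: 'I_S]%SET| = S.-1.+1.
  by rewrite cardsT card_ord prednK // (leq_ltn_trans _ (ltn_ord j)).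
have [r [rinj rgap]] := exists_rank g0 gap cS.
pose F (m : 'I_S.-1.+1) : R := ((m%:R - (r j)%:R) ^+ 2)^-1 / alpha ^+ 2.
have rT : r @: [set: 'I_S]%SET = [set: 'I_S.-1.+1]%SET.
  apply/eqP; rewrite eqEcard finset.subsetT card_in_imset // cS.
  by rewrite cardsT card_ord leqnn.
apply: (@le_trans _ _ (\sum_(k | k != j) F (r k))); last first.
  rewrite (_ : \sum_(k | k != j) F (r k) = \sum_(m | m != r j) F m); last first.
    transitivity (\sum_(m in r @: [set: 'I_S]%SET | m != r j) F m); last first.
      by rewrite rT; apply: eq_bigl => m; rewrite inE.
    rewrite big_imset_cond //=; apply: eq_bigl => k; rewrite inE /=.
    by rewrite (inj_in_eq rinj) ?inE.
  rewrite -mulr_suml ler_wpM2r ?invr_ge0 ?sqr_ge0 //.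
  exact: sum_inv_sqr_dist_le4.
apply: ler_sum => k kj.
have d0 : 0 < distT (omega k - omega j) by apply: lt_le_trans (sep _ _ kj).
have := rgap k j (finset.in_setT _) (finset.in_setT _).
rewrite uj subr0 -nE => h.
have rk : (r k)%:R - (r j)%:R != 0 :> R.
  rewrite subr_eq0 eqr_nat; apply: contra kj => /eqP/val_inj/rinj rkj.
  by rewrite rkj ?inE.
rewrite /F -invfM exprVn lef_pV2 ?posrE; last 2 first.
- by rewrite exprn_gt0 // mulr_gt0.
- by apply: mulr_gt0; [rewrite exprn_even_gt0 | exact: exprn_gt0].
rewrite mulrC -[X in _ * X]real_normK ?num_real // -exprMn.
apply: lerXn2r; rewrite ?nnegrE ?mulr_ge0 ?distT_ge0 ?(ltW a0) //.
by move: h; rewrite mulrAC ler_pdivrMr // [distT _ * _]mulrC.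
Qed.

Section LowerBound.
Variables (R : realType) (A L S : nat) (alpha beta : R).
Variables (omega : 'I_S -> R) (Lam : 'I_A -> {set 'I_S}).
Hypotheses (S_gt0 : (0 < S)%N) (SL : (S <= L)%N).
Hypotheses (alpha_gt0 : 0 < alpha) (beta_gt0 : 0 < beta).
Hypothesis clumps : clumps_model L beta alpha omega Lam.
Hypothesis beta_ge : forall a : 'I_A,
  20 * Num.sqrt S%:R * #|Lam a|%:R `^ (5 / 2) / Num.sqrt alpha <= beta.

Let T := \sum_(a < A) (clump_C R #|Lam a| L * alpha ^- #|Lam a|.-1) ^+ 2.

Let L_gt0 : (0 < L)%N. Proof. exact: leq_trans SL. Qed.
Let LR_gt0 : 0 < L%:R :> R. Proof. by rewrite ltr0n. Qed.
Let SR_gt0 : 0 < S%:R :> R. Proof. by rewrite ltr0n. Qed.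

Let exists_clump : exists cl : 'I_S -> 'I_A, forall j a,
  (j \in Lam a) = (cl j == a).
Proof.
have cov j : exists a, j \in Lam a.
  have : j \in (\bigcup_(a < A) Lam a)%SET by rewrite (clumps_cover clumps) inE.
  by case/finset.bigcupP => a _ ja; exists a.
have [cl clP] := fin_all_exists cov.
exists cl => j a; apply/idP/eqP => [ja|<- //].
apply/eqP/negPn/negP => /(clumps_disjoint clumps) /setP/(_ j).
by rewrite !inE clP ja.
Qed.

Let card_clump_le a : (#|Lam a| <= L)%N.
Proof. by apply: leq_trans SL; rewrite -[X in (_ <= X)%N]card_ord max_card. Qed.

Let card_clump_gt0 a : (0 < #|Lam a|)%N.
Proof. by rewrite card_gt0 (clumps_neq0 clumps). Qed.

Let sqr_beta_ge a :
  400 * S%:R * #|Lam a|%:R ^+ 5 / alpha <= beta ^+ 2.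
Proof.
have h := beta_ge a.
have : (20 * Num.sqrt S%:R * #|Lam a|%:R `^ (5 / 2) / Num.sqrt alpha) ^+ 2 <=
  beta ^+ 2.
  apply: lerXn2r => //; last by rewrite nnegrE ltW.
  rewrite nnegrE.
  by rewrite divr_ge0 ?sqrtr_ge0 // !mulr_ge0 ?sqrtr_ge0 ?powR_ge0.
apply: le_trans; rewrite !exprMn exprVn !sqr_sqrtr ?ler0n ?(ltW alpha_gt0) //.
have -> : (#|Lam a|%:R `^ (5 / 2)) ^+ 2 = #|Lam a|%:R ^+ 5 :> R.
  rewrite -powR_mulrn ?powR_ge0 // -powRrM -powR_mulrn ?ler0n //.
  by congr (_ `^ _); field.
by rewrite le_eqVlt; apply/orP; left; apply/eqP; congr (_ * _ * _ / _); ring.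
Qed.

Section Assignment.
Variable cl : 'I_S -> 'I_A.
Hypothesis clE : forall j a, (j \in Lam a) = (cl j == a).
Local Notation lam j := #|Lam (cl j)|.

Let jL j : j \in Lam (cl j). Proof. by rewrite clE. Qed.

Let p j := clump_poly L omega (Lam (cl j)) j.

(** Interpolation is exact on the clump of [j], so errors come only from other clumps. *)
Let e k j := if cl k == cl j then 0 else cmod (p j).[node (omega k)].

Let sep := clumps_minsep clumps.

Let p_interp k j : cmod ((p j).[node (omega k)] - (k == j)%:R) <= e k j.
Proof.
rewrite /e; case: ifP => [|kj]; last first.
  have /negPf -> : k != j by apply: contraFneq kj => ->.
  by rewrite subr0.
rewrite -clE => kL; have [->|kj] := eqVneq k j.
  rewrite (clump_poly_self alpha_gt0 (card_clump_le _) (clumps_arc clumps _)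
    sep (jL j)).
  by rewrite subrr cmod0.
by rewrite subr0 clump_poly_other ?cmod0.
Qed.

Let e_le k j : cl k != cl j ->
  e k j <= ((lam j)%:R / alpha) ^+ (lam j).-1 *
    ((lam j)%:R ^+ 2 / (L%:R * distT (omega k - omega j))) ^+ (2 * lam j).
Proof.
move=> kj; rewrite /e (negPf kj).
have d0 : 0 < distT (omega k - omega j).
  apply: lt_le_trans (sep _); first by rewrite divr_gt0.
  by apply: contra kj => /eqP ->.
apply: le_trans (clump_poly_value_le alpha_gt0 (card_clump_le _)
  (clumps_arc clumps _) sep (jL j) _) _.
rewrite ler_wpM2l ?exprn_ge0 ?divr_ge0 ?ler0n ?(ltW alpha_gt0) //.
apply: lerXn2r; rewrite ?nnegrE ?cmod_ge0 ?divr_ge0 ?sqr_ge0 ?mulr_ge0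
  ?distT_ge0 //.
apply: le_trans (dirichlet_far _ d0) _.
set q := (_ %/ _)%N; have q0 : 0 < q.+1%:R :> R by rewrite ltr0n.
rewrite -[leLHS]mul1r ler_pdivrMr ?mulr_gt0 //.
rewrite mulrAC ler_pdivlMr ?mulr_gt0 // mul1r.
have -> : (lam j)%:R ^+ 2 * (2 * q.+1%:R * distT (omega k - omega j)) =
   2 * (lam j)%:R ^+ 2 * q.+1%:R * distT (omega k - omega j) by ring.
by rewrite ler_wpM2r ?distT_ge0 // (lam_sqr_lt R L (jL j)).
Qed.

(** The hypothesis on beta bounds the square of the kernel term by alpha/D with D = 400 S lambda.
    The product becomes (lambda/D)^(lambda-1) alpha/D <= alpha/D <= 20/D. *)
Let e_uniform k j : alpha <= 20 -> e k j <= (20 * S%:R)^-1.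
Proof.
move=> a20; have [kj|kj] := eqVneq (cl k) (cl j).
  by rewrite /e kj eqxx invr_ge0 mulr_ge0 // ler0n.
apply: le_trans (e_le kj) _.
set l := lam j; have l0 : 0 < l%:R :> R by rewrite ltr0n card_clump_gt0.
have dist_ge := clumps_dist clumps kj (jL k) (jL j).
have d0 : 0 < distT (omega k - omega j).
  by apply: lt_le_trans dist_ge; rewrite divr_gt0.
have far : (l%:R ^+ 2 / (L%:R * distT (omega k - omega j))) ^+ 2 <=
    alpha / (400 * S%:R * l%:R).
  apply: (@le_trans _ _ ((l%:R ^+ 2 / beta) ^+ 2)).
    apply: lerXn2r; rewrite ?nnegrE ?divr_ge0 ?sqr_ge0 ?mulr_ge0 ?distT_ge0
      ?(ltW beta_gt0) //.
    by rewrite ler_pM2l ?exprn_gt0 // lef_pV2 ?posrE ?mulr_gt0 //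
      -ler_pdivrMl // mulrC.
  rewrite expr_div_n ler_pdivrMr ?exprn_gt0 // mulrC.
  have := sqr_beta_ge (cl j); rewrite -/l => h.
  apply: le_trans (ler_wpM2r _ h);
    last by rewrite divr_ge0 ?mulr_ge0 ?ler0n ?(ltW alpha_gt0).
  by rewrite le_eqVlt; apply/orP; left; apply/eqP; field; rewrite !gt_eqF.
have S1 : 1 <= S%:R :> R by rewrite ler1n.
have l1 : 1 <= l%:R :> R by rewrite ler1n card_clump_gt0.
have l_le : l%:R <= S%:R * l%:R :> R by rewrite ler_peMl // ler0n.
have D_eq : (20 * S%:R)^-1 * (400 * S%:R * l%:R) = 20 * l%:R :> R.
  by field; rewrite gt_eqF.
have D_le : l%:R <= 400 * S%:R * l%:R :> R by lra.
set D := 400 * S%:R * l%:R in far D_eq D_le.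
have D_gt0 : 0 < D by apply: lt_le_trans D_le.
have c0 : 0 <= l%:R / D by rewrite divr_ge0 // ltW.
have c1 : l%:R / D <= 1 by rewrite ler_pdivrMr // mul1r.
have aD : 0 <= alpha / D by rewrite divr_ge0 // ltW.
rewrite exprM; set y := (_ ^+ 2) in far *.
have y0 : 0 <= y by rewrite sqr_ge0.
apply: (@le_trans _ _ ((l%:R / alpha) ^+ l.-1 * (alpha / D) ^+ l)).
  apply: ler_wpM2l.
    by rewrite exprn_ge0 // divr_ge0 ?ler0n // ltW.
  have y1 : y \in Num.nneg by rewrite nnegrE.
  have y2 : alpha / D \in Num.nneg by rewrite nnegrE.
  exact: lerXn2r y1 y2 far.
have lE x : x ^+ l = x * x ^+ l.-1 :> R.
  by rewrite -exprS prednK // /l card_clump_gt0.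
rewrite lE mulrCA -exprMn.
have -> : l%:R / alpha * (alpha / D) = l%:R / D.
  by rewrite mulrA mulfVK // gt_eqF.
apply: (@le_trans _ _ (alpha / D)).
  by apply: ler_piMr => //; exact: exprn_ile1.
by rewrite ler_pdivrMr // D_eq; lra.
Qed.

(** From lambda - 1 < 1/alpha < 1 the clump is a single point, and [e_le] reduces to the square of
    the kernel bound. *)
Let e_singletons k j : 20 < alpha -> k != j ->
  e k j <= ((L%:R * distT (omega k - omega j))^-1) ^+ 2.
Proof.
move=> a20 kj.
have l1 : lam j = 1%N.
  have := clumps_card clumps (cl j); have := card_clump_gt0 (cl j).
  case: (lam j) => [//|[//|m]] _; rewrite -!natr1 => h.
  have : alpha^-1 < 1 by rewrite invf_lt1 //; lra.
  have : (0 : R) <= m%:R by rewrite ler0n.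
  by move=> m0 a1; exfalso; lra.
have [ckj|ckj] := eqVneq (cl k) (cl j).
  by rewrite /e ckj eqxx sqr_ge0.
by apply: le_trans (e_le ckj) _; rewrite l1 expr0 expr1n !mul1r.
Qed.

Let e_self j : e j j = 0. Proof. by rewrite /e eqxx. Qed.

(** For alpha <= 20, S terms of at most 1/(20 S); for alpha > 20, the inverse squares sum to at most
    4/alpha^2 < 1/100. *)
Let e_col j : \sum_k e k j <= 1 / 20.
Proof.
have [a20|a20] := leP alpha 20.
  apply: (@le_trans _ _ (\sum_(k < S) (20 * S%:R)^-1)).
    by apply: ler_sum => k _; exact: e_uniform.
  rewrite sumr_const card_ord -[_ *+ _]mulr_natl.
  by rewrite le_eqVlt; apply/orP; left; apply/eqP; field; rewrite gt_eqF.
rewrite (bigD1 j) //= e_self add0r.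
apply: le_trans (ler_sum _ (fun k kj => e_singletons a20 kj)) _.
apply: le_trans (sum_inv_sqr_distT_le _ alpha_gt0 L_gt0 sep) _.
by rewrite ler_pdivrMr ?exprn_gt0 //; nra.
Qed.

Let e_row k : \sum_j e k j <= 1 / 20.
Proof.
have [a20|a20] := leP alpha 20.
  apply: (@le_trans _ _ (\sum_(k < S) (20 * S%:R)^-1)).
    by apply: ler_sum => j _; exact: e_uniform.
  rewrite sumr_const card_ord -[_ *+ _]mulr_natl.
  by rewrite le_eqVlt; apply/orP; left; apply/eqP; field; rewrite gt_eqF.
rewrite (bigD1 k) //= e_self add0r.
apply: (@le_trans _ _ (\sum_(j | j != k) ((L%:R * distT (omega j - omega
  k))^-1) ^+ 2)).
  apply: ler_sum => j jk; rewrite -distTN opprB; apply: e_singletons => //.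
  by rewrite eq_sym.
apply: le_trans (sum_inv_sqr_distT_le _ alpha_gt0 L_gt0 sep) _.
by rewrite ler_pdivrMr ?exprn_gt0 //; nra.
Qed.

Let T_ge0 : 0 <= T.
Proof. by apply: sumr_ge0 => a _; rewrite sqr_ge0. Qed.

Let p_norm : \sum_j coef_norm L.+1 (p j) ^+ 2 <= (19 / 20 * Num.sqrt (T /
  L%:R)) ^+ 2.
Proof.
rewrite exprMn sqr_sqrtr ?divr_ge0 ?ler0n //.
have -> : (19 / 20) ^+ 2 * (T / L%:R) = (19 / 20) ^+ 2 / L%:R * T by ring.
rewrite (partition_big cl predT) //= mulr_sumr; apply: ler_sum => a _.
apply: le_trans (sum_coef_norm_clump alpha_gt0 (card_clump_le a)
  (clumps_arc clumps a) sep L.+1 (card_clump_gt0 a)).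
rewrite le_eqVlt; apply/orP; left; apply/eqP; apply: eq_big => j.
  by rewrite clE.
by move=> /eqP ja; rewrite /p ja.
Qed.

Lemma vandermonde_clumps_le v : l2norm v <=
  Num.sqrt (T / L%:R) *
  l2norm ((\matrix_(m < L.+1, j < S) node (omega j) ^+ m) *m v).
Proof.
have K_ge0 : 0 <= 19 / 20 * Num.sqrt (T / L%:R).
  by rewrite mulr_ge0 ?sqrtr_ge0 // divr_ge0.
have size_p j : (size (p j) <= L.+1)%N.
  by apply: size_clump_poly (jL j); exact: card_clump_le.
have := vandermonde_lower_bound size_p p_interp e_row e_col K_ge0 p_norm v.
have -> : (1 - 1 / 20 : R) = 19 / 20 by field.
by rewrite -[leRHS]mulrA ler_pM2l ?divr_gt0.
Qed.

End Assignment.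

Lemma fourier_lower_bound :
  0 < T /\ forall v, Num.sqrt (L%:R / T) * l2norm v <= l2norm (fourier_mx L
    omega *m v).
Proof.
have [cl clE] := exists_clump.
have FE : fourier_mx L omega = \matrix_(m < L.+1, j < S) node (omega j) ^+ m.
  apply/matrixP => m j; rewrite !mxE nodeX /node; congr cexpi; ring.
have h := vandermonde_clumps_le clE; rewrite -FE in h.
(* Were T zero, the bound would force the all-ones vector to have norm 0. *)
have T0 : 0 < T.
  rewrite lt_neqAle sumr_ge0 => [|a _]; last exact: sqr_ge0.
  rewrite andbT; apply/negP => /eqP T0.
  have := h (const_mx 1); rewrite -T0 mul0r sqrtr0 mul0r.
  apply/negP; rewrite -ltNge l2norm_gt0;
    apply/negP => /eqP/colP/(_ (Ordinal S_gt0)).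
  by rewrite !mxE => /eqP; rewrite oner_eq0.
split=> // v; rewrite -invf_div sqrtrV ?divr_ge0 ?ler0n ?(ltW T0) //.
by rewrite mulrC ler_pdivrMr ?sqrtr_gt0 ?divr_gt0 // mulrC.
Qed.

End LowerBound.

(** * MUSIC *)

Section HankelData.
Local Open Scope sesquilinear_scope.
Variable R : realType.

Lemma l2norm_conj n (v : 'cV[R[i]]_n) : l2norm (map_mx Num.conj v) = l2norm v.
Proof. by congr Num.sqrt; apply: eq_bigr => i _; rewrite mxE cmod_conj. Qed.

Lemma hankelD M L (y z : 'cV[R[i]]_M.+1) :
  hankel L (y + z) = hankel L y + hankel L z.
Proof. by apply/matrixP => p q; rewrite !mxE. Qed.

(** z^(p+q) = z^p z^q. Conjugation followed by the adjoint is a transpose; this is the shape that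
    the perturbation bounds expect. *)
Lemma hankel_fourier M L S (omega : 'I_S -> R) (x : 'cV[R[i]]_S) : (L <= M)%N ->
  hankel L (fourier_mx M omega *m x) =
  fourier_mx L omega *m diag_mx x^T *m
    (map_mx Num.conj (fourier_mx (M - L) omega)) ^t*.
Proof.
move=> LM; apply/matrixP => a b; rewrite mxE [LHS]mxE [RHS]mxE.
apply: eq_bigr => j _; rewrite mul_mx_diag !mxE conjCK.
have abM : (a + b < M.+1)%N by have := ltn_ord a; have := ltn_ord b; lia.
rewrite inordK // [RHS]mulrAC -cexpiD; congr (cexpi _ * _).
by rewrite natrD; ring.
Qed.

Lemma steering_neq0 L (w : R) : steering L w != 0.
Proof.
apply/eqP => /colP/(_ ord0); rewrite !mxE mulr0 mul0r oppr0 cexpi0.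
by move/eqP; rewrite oner_eq0.
Qed.

End HankelData.

Unset Implicit Arguments.

Theorem theorem4p3 (R : realType) (A M S L : nat)
  (hA : (0 < A)%N) (hM : (0 < M)%N) (hS : (0 < S)%N)
  (hMS : (S ^ 2 <= M)%N) (hMeven : ~~ odd M) (hL : L = (M %/ 2)%N)
  (alpha beta : R) (halpha : 0 < alpha) (hbeta : 0 < beta)
  (omega : 'I_S -> R) (Lam : 'I_A -> {set 'I_S})
  (hclumps : clumps_model L beta alpha omega Lam)
  (hbeta_sep : forall a : 'I_A,
     20 * Num.sqrt S%:R * #|Lam a|%:R `^ (5 / 2) / Num.sqrt alpha <= beta)
  (x : 'cV[R[i]]_S) (eta y : 'cV[R[i]]_M.+1)
  (hy : y = fourier_mx M omega *m x + eta)
  (xmin : R) (hxmin : xmin = inf (range (fun j : 'I_S => cmod (x j 0))))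
  (c : 'I_A -> R) (hc : forall a, c a = clump_C R #|Lam a| L)
  (hnoise : 4 * spectral_norm (hankel L eta)
              * (\sum_(a < A) (c a * alpha ^- (#|Lam a|.-1)) ^+ 2)
            < xmin * M%:R)
  (k : nat) (W : 'M[R[i]]_(L.+1, k))
  (hW : orthobasis_range_perp (hankel L (fourier_mx M omega *m x)) W)
  (U : 'M[R[i]]_L.+1) (Sigma : 'M[R]_(L.+1, (M - L).+1))
  (V : 'M[R[i]]_((M - L).+1))
  (hsvd : is_svd (hankel L y) U Sigma V) :
  (ereal_sup [set (`|noise_corr (last_cols S U) w - noise_corr W w|)%:E
             | w in `[0%R : R, 1%R[%classic]
   <= (4 * spectral_norm (hankel L eta) / (xmin * M%:R)
       * (\sum_(a < A) (c a * alpha ^- (#|Lam a|.-1)) ^+ 2))%:E)%E.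
Proof.
(* M is even, so the Hankel matrix is square and both its Fourier factors obey the same lower
   bound. *)
have LM : (M - L)%N = L by rewrite hL divn2; lia.
have L_le_M : (L <= M)%N by rewrite hL leq_div.
(* For S >= 2, S <= S^2/2 <= L; for S = 1, M is even and positive, so L >= 1. *)
have SL : (S <= L)%N by rewrite hL divn2; nia.
have M2 : M%:R = 2 * L%:R :> R by rewrite -natrM; congr _%:R; lia.
have L0 : 0 < L%:R :> R by rewrite ltr0n (leq_trans hS).
set T := \sum_(a < A) _ in hnoise *.
have TE : T = \sum_(a < A) (clump_C R #|Lam a| L * alpha ^- #|Lam a|.-1) ^+ 2.
  by apply: eq_bigr => a _; rewrite hc.
have [T0 lower] := fourier_lower_bound hS SL halpha hbeta hclumps hbeta_sep.
rewrite -TE in T0 lower.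
have E0 := spectral_norm_ge0 (hankel L eta).
set nE := spectral_norm _ in hnoise E0 *.
have M0 : 0 < M%:R :> R by rewrite ltr0n.
(* The left side of the noise hypothesis is nonnegative, so its strictness makes [xmin] positive. *)
have xmin0 : 0 < xmin.
  rewrite -(pmulr_lgt0 _ M0); apply: le_lt_trans hnoise.
  by rewrite !mulr_ge0 // ltW.
have s0 : 0 < Num.sqrt (L%:R / T) by rewrite sqrtr_gt0 divr_gt0.
have s2 : xmin * Num.sqrt (L%:R / T) ^+ 2 = xmin * L%:R / T.
  by rewrite sqr_sqrtr ?mulrA // divr_ge0 // ltW.
have e_lt : 2 * nE < xmin * Num.sqrt (L%:R / T) ^+ 2.
  by rewrite s2 ltr_pdivlMr //; move: hnoise; rewrite M2; lra.
have dge j : xmin <= cmod (x^T 0 j).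
  rewrite mxE hxmin; apply: ge_inf; last by exists j.
  by exists 0 => _ [i _ <-]; exact: cmod_ge0.
have Bge v : Num.sqrt (L%:R / T) * l2norm v <=
    l2norm ((map_mx Num.conj (fourier_mx (M - L) omega)) *m v).
  rewrite -[v in leRHS](_ : map_mx Num.conj (map_mx Num.conj v) = v); last first.
    by apply/colP => i; rewrite !mxE conjCK.
  by rewrite -map_mxM l2norm_conj LM -(l2norm_conj v).
move: hW hsvd; rewrite hy hankelD (hankel_fourier _ _ L_le_M) => hW hsvd.
have SN : (S <= M - L)%N by rewrite LM.
have Ele := l2norm_mul_le (hankel L eta).
(* M = 2 L turns the stated constant into 2 e / sigma with sigma = xmin L / T. *)
have deltaE : 4 * nE / (xmin * M%:R) * T = 2 * nE / (xmin * Num.sqrt (L%:R / T) ^+ 2).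
  by rewrite s2 M2; field; rewrite !gt_eqF.
apply: ge_ereal_sup => _ [w _ <-]; rewrite lee_fin deltaE /noise_corr.
have n0 : 0 < l2norm (steering L w) by rewrite l2norm_gt0 steering_neq0.
rewrite -mulrBl normrM [X in _ * X]ger0_norm ?invr_ge0 ?l2norm_ge0 //.
rewrite ler_pdivrMr // ler_norml; apply/andP; split.
  rewrite lerBrDl addrC -lerBrDl opprK.
  exact: (corr_le_last_cols hS SL SN s0 xmin0 lower Bge dge Ele E0 e_lt hsvd hW).
rewrite lerBlDl.
exact: (last_cols_corr_le hS SL SN s0 xmin0 lower Bge dge Ele E0 e_lt hsvd hW).
Qed.
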